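(* Let $\gamma_0$ be the unique positive solution of \[ \frac{1}{e} + \frac{1}{e^{\gamma_0}} - (\gamma_0 - 1)\Big(1 - \frac{1}{e} + \frac{1}{e^{\gamma_0}}\Big) = 0 \] ($\gamma_0 \approx 1.67736$). For every instance of the metric uncapacitated facility location problem, Algorithm $A1(\gamma_0)$ (described in the context) produces a feasible solution whose expected total cost satisfies \[ E[\mathrm{cost}(SOL)] \le \gamma_0 \cdot F^* + \Big(1 + \frac{2}{e^{\gamma_0}}\Big) \cdot C^*, \] where $F^* = \sum_{i} f_i y^*_i$ and $C^* = \sum_{i,j} c_{ij} x^*_{ij}$ are the facility cost and connection cost of the optimal LP solution $(x^*,y^* )$ computed in Step 1 of the algorithm.
   Context: Metric uncapacitated facility location (UFL): a finite set $\mathcal{F}$ of facilities with opening costs $f_i \ge 0$, a finite set $\mathcal{C}$ of clients, and connection costs $c_{ij}\ge 0$ ($i\in\mathcal{F}$, $j\in\mathcal{C}$) satisfying $c_{ij} \le c_{ij'} + c_{i'j'} + c_{i'j}$ for all $i,i'\in\mathcal{F}$, $j,j'\in\mathcal{C}$. A solution opens a set of facilities and connects each client to an open facility; its cost is the total opening cost plus the total connection cost. LP relaxation: minimize $\sum_{i,j} c_{ij}x_{ij} + \sum_i f_i y_i$ s.t. $\sum_i x_{ij}=1$ for all $j$, $x_{ij}\le y_i$, $x_{ij}\ge 0$. Algorithm $A1(\gamma)$, for a parameter $\gamma>1$: 1. Solve the LP relaxation to obtain an optimal solution $(x^*,y^* )$. 2. Set $\tilde y = \gamma y^*$. For each client $j$,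 order facilities by nondecreasing $c_{ij}$ and assign $j$ greedily: $\tilde x_{ij} = \min(\tilde y_i, 1 - \text{amount already assigned})$ along the order, so that if $\tilde x_{ij} < \tilde y_i$ then $\tilde x_{i'j}=0$ for every later $i'$. Then repeatedly split any facility $i$ with some $0<\tilde x_{ij}<\tilde y_i$ into two copies (same costs and distances) with openings $\tilde x_{ij}$ and $\tilde y_i-\tilde x_{ij}$, updating the $x$-values accordingly, until obtaining a complete solution $(\bar x,\bar y)$: no pair $i,j$ with $0<\bar x_{ij}<\bar y_i$. For each copy $i$ set $y^*_i=\bar y_i/\gamma$. 3. For a client $j$ let $\mathcal{C}_j=\{i: \bar x_{ij}>0\}$ (close facilities), $D^C_{av}(j)=\sum_{i\in\mathcal{C}_j} c_{ij}y^*_i/\sum_{i\in\mathcal{C}_j}y^*_i$ and $D^C_{max}(j)=\max_{i\in\mathcal{C}_j}c_{ij}$. Two clients are neighbors if they share a close facility. While unclustered clients remain, choose as cluster center an unclustered client $j$ minimizing $D^C_{av}(j)+D^C_{max}(j)$, and form a cluster from $j$ and all its unclustered neighbors. 4. For every cluster center $j$, open exactly one of its close facilities, choosing $i\in\mathcal{C}_j$ with probability $\bar x_{ij}$. 5. Open each facility that is not a close facility of any cluster center independently with probability $\bar y_i$. 6. Connect each client to a closest open facility. *)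

(* Defs.v *)
From HB Require Import structures.
From mathcomp Require Import all_boot all_order all_algebra.
From mathcomp Require Import reals sequences exp.

Set Implicit Arguments.
Unset Strict Implicit.
Unset Printing Implicit Defensive.

Import Order.TTheory GRing.Theory Num.Theory.
Local Open Scope ring_scope.

Record ufl (R : realType) (F C : finType) := Ufl {
  fcost : F -> R;
  ccost : F -> C -> R;
  fcost_ge0 : forall i, 0 <= fcost i;
  ccost_ge0 : forall i j, 0 <= ccost i j;
  ccost_metric : forall i i' j j',
    ccost i j <= ccost i j' + ccost i' j' + ccost i' j
}.

Record solution (F C : finType) := Solution {
  sol_open : {set F};
  sol_conn : C -> F
}.

Definition sol_feasible (F C : finType) (s : solution F C) : Prop :=
  forall j, sol_conn s j \in sol_open s.

Definition sol_cost (R : realType) (F C : finType) (I : ufl R F C)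
    (s : solution F C) : R :=
  \sum_(i in sol_open s) fcost I i + \sum_j ccost I (sol_conn s j) j.

Section LP.
Variables (R : realType) (F C : finType) (I : ufl R F C).
Implicit Types (x : F -> C -> R) (y : F -> R).

Definition lp_fcost y : R := \sum_i fcost I i * y i.
Definition lp_ccost x : R := \sum_i \sum_j ccost I i j * x i j.

(* [0 <= y i] follows from [0 <= x i j <= y i] as soon as there is a client; it
   is listed so that the LP is also meaningful when there are no clients. *)
Definition lp_feasible x y : Prop :=
  [/\ forall j, \sum_i x i j = 1,
      forall i j, x i j <= y i,
      forall i j, 0 <= x i j
    & forall i, 0 <= y i].

Definition lp_optimal x y : Prop :=
  lp_feasible x y /\
  forall x' y', lp_feasible x' y' ->
    lp_ccost x + lp_fcost y <= lp_ccost x' + lp_fcost y'.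

End LP.

(* Amount that a client still requiring [rem] receives from [i], when the
   facilities are served in the order [s]. *)
Fixpoint greedy (R : realType) (F : finType) (y : F -> R) (s : seq F) (rem : R)
    (i : F) : R :=
  if s is k :: s' then
    let a := Num.min (y k) rem in
    if i == k then a else greedy y s' (rem - a) i
  else 0.

Definition nearest_order (R : realType) (F C : finType) (I : ufl R F C) (j : C)
    (s : seq F) : Prop :=
  perm_eq s (enum F) /\ sorted (fun i i' => ccost I i j <= ccost I i' j) s.

Record copy (R : realType) (F C : finType) := Copy {
  cp_fac : F;
  cp_open : R;
  cp_conn : C -> R
}.

Definition init_copies (R : realType) (F C : finType) (yt : F -> R)
    (ord : C -> seq F) : seq (copy R F C) :=
  [seq Copy i (yt i) (fun j => greedy yt (ord j) 1 i) | i <- enum F].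

(* [k] is split into [k1], [k2] on account of client [j].  The connection of any
   other client may be shared between the two copies in any way that respects
   their openings. *)
Definition is_split (R : realType) (F C : finType) (j : C)
    (k k1 k2 : copy R F C) : Prop :=
  [/\ cp_fac k1 = cp_fac k /\ cp_fac k2 = cp_fac k,
      cp_open k1 = cp_conn k j,
      cp_open k2 = cp_open k - cp_conn k j,
      cp_conn k1 j = cp_conn k j
    & forall j',
        [/\ cp_conn k1 j' + cp_conn k2 j' = cp_conn k j',
            0 <= cp_conn k1 j' <= cp_open k1
          & 0 <= cp_conn k2 j' <= cp_open k2]].

Inductive splits_to (R : realType) (F C : finType) :
    seq (copy R F C) -> seq (copy R F C) -> Prop :=
| splits_refl s : splits_to s s
| splits_step s1 k k1 k2 s2 s' j :
    0 < cp_conn k j < cp_open k -> is_split j k k1 k2 ->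
    splits_to (s1 ++ k1 :: k2 :: s2) s' -> splits_to (s1 ++ k :: s2) s'.

Section Copies.
Variables (R : realType) (F C : finType) (I : ufl R F C) (gamma : R).
Variable s : seq (copy R F C).

(* Copies are identified by their position in [s]. *)
Let K := 'I_(size s).

Definition fac (k : K) : F := cp_fac (tnth (in_tuple s) k).
Definition ybar (k : K) : R := cp_open (tnth (in_tuple s) k).
Definition xbar (k : K) (j : C) : R := cp_conn (tnth (in_tuple s) k) j.
Definition ystar (k : K) : R := ybar k / gamma.

Definition complete_sol : Prop := forall k j, ~~ (0 < xbar k j < ybar k).

Definition close (j : C) : {set K} := [set k | 0 < xbar k j].

Definition neighbors (j j' : C) : bool := [exists k, k \in close j :&: close j'].

Definition Dav (j : C) : R :=
  (\sum_(k in close j) ccost I (fac k) j * ystar k)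
    / \sum_(k in close j) ystar k.

(* The base value 0 is harmless: connection costs are nonnegative. *)
Definition Dmax (j : C) : R := \big[Num.max/0]_(k in close j) ccost I (fac k) j.

(* [clustering U cs]: starting with the set [U] of unclustered clients, [cs] is a
   possible sequence of successively chosen cluster centers. *)
Inductive clustering : {set C} -> seq C -> Prop :=
| clustering_nil : clustering set0 [::]
| clustering_cons (U : {set C}) j cs :
    j \in U ->
    (forall j', j' \in U -> Dav j + Dmax j <= Dav j' + Dmax j') ->
    clustering (U :\: [set j' in U | (j' == j) || neighbors j j']) cs ->
    clustering U (j :: cs).

Variable cs : seq C.

(* Copies that are close to some cluster center. *)
Definition clustered : {set K} := [set k | has (fun j => k \in close j) cs].

(* An elementary outcome: the copy chosen for each cluster center, and the set of
   successful coins, one coin being flipped for every copy.  All choices and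
   coins are independent. *)
Definition outcome : finType := ({ffun 'I_(size cs) -> K} * {set K})%type.

(* When [f i = 0] the LP may set [y i] arbitrarily high, and then [ybar k] can
   exceed 1 for a copy that no client uses; hence the truncation. *)
Definition coin (k : K) : R := Num.min 1 (ybar k).

(* A copy that is not close to center [j] is chosen for it with probability
   [xbar k j = 0]. *)
Definition prob (w : outcome) : R :=
  (\prod_(t < size cs) xbar (w.1 t) (tnth (in_tuple cs) t)) *
  (\prod_k (if k \in w.2 then coin k else 1 - coin k)).

(* The coins of clustered copies are ignored. *)
Definition opened_copies (w : outcome) : {set K} :=
  [set w.1 t | t : 'I_(size cs)] :|: (w.2 :\: clustered).

Definition opened (w : outcome) : {set F} := [set fac k | k in opened_copies w].

(* Nothing is required of [i] when nothing is open. *)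
Definition closest_open (w : outcome) (j : C) (i : F) : Prop :=
  opened w != set0 ->
  i \in opened w /\
  forall i', i' \in opened w -> ccost I i j <= ccost I i' j.

Definition expectation (X : outcome -> R) : R := \sum_w prob w * X w.

End Copies.

(* The record collects everything that the algorithm does not determine uniquely:
   the LP solution, the tie breaking, the splitting, the centers. *)
Record run (R : realType) (F C : finType) := Run {
  run_x : F -> C -> R;
  run_y : F -> R;
  run_ord : C -> seq F;
  run_copies : seq (copy R F C);
  run_centers : seq C;
  run_conn : outcome run_copies run_centers -> C -> F
}.
Arguments run_conn {R F C} r w j.

Record A1_run (R : realType) (F C : finType) (I : ufl R F C) (gamma : R)
    (r : run R F C) : Prop := A1Run {
  A1_lp : lp_optimal I (run_x r) (run_y r);
  A1_ord : forall j, nearest_order I j (run_ord r j);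
  A1_split :
    splits_to (init_copies (fun i => gamma * run_y r i) (run_ord r))
              (run_copies r);
  A1_complete : complete_sol (run_copies r);
  A1_cluster : clustering I gamma (run_copies r) setT (run_centers r);
  A1_connect : forall w j, closest_open I w j (run_conn r w j)
}.

(* A solution of the original instance: a facility is open, and paid once, as soon
   as one of its copies is open. *)
Definition A1_solution (R : realType) (F C : finType) (r : run R F C)
    (w : outcome (run_copies r) (run_centers r)) : solution F C :=
  Solution (opened w) (run_conn r w).
Arguments A1_solution {R F C} r w.

Definition gamma_eq (R : realType) (g : R) : Prop :=
  (expR 1)^-1 + (expR g)^-1
    - (g - 1) * (1 - (expR 1)^-1 + (expR g)^-1) = 0.

(* Main.v *)
(* Fix a client j and let b assign mass 1 to its close copies and mass gamma - 1
   to more distant ones, with total connection cost at most gamma times the LP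
   connection cost of j.  For any set of copies of b-mass u, all of them stay
   closed with probability at most exp(-u): a center contributes a factor
   1 - (its mass), a coin likewise.  Serve j by the nearest open copy carrying
   mass, and otherwise by the copy opened for the center j' of its cluster.  Given
   that only the last resort remains, averaging the detour through a copy i
   serving j' over all such i bounds its expected cost by
     B = 2 Dmax(j) + Dav(j) + sum over distant k of b(k) (c(k,j) - Dmax(j)).
   Replacing exp(-u) by its chords over [0,1] and [1,gamma] and summing by parts,
   the expected cost of j is at most
     (1 - 1/e) D + (1/e - 1/e^gamma) D' + B / e^gamma,
   where D and D' are the average costs of the close and the distant mass and
   B <= D + 2 D'.  The equation defining gamma0 makes the coefficients of D and
   (gamma - 1) D' both equal to 1 - 1/e + 1/e^gamma. *)

From mathcomp Require Import boolp classical_sets topology normedtype.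
From mathcomp Require Import function_spaces derive.
Require Import Defs.
From HB Require Import structures.
From mathcomp Require Import all_boot all_order all_algebra.
From mathcomp Require Import reals sequences exp ring lra.

Set Implicit Arguments.
Unset Strict Implicit.
Unset Printing Implicit Defensive.

Import Order.TTheory GRing.Theory Num.Theory numFieldNormedType.Exports.
Local Open Scope ring_scope.

(** * The parameter *)

Lemma gamma_eq_factor (R : realType) (g : R) : gamma_eq g ->
  (expR 1)^-1 + (expR g)^-1 = (g - 1) * (1 - (expR 1)^-1 + (expR g)^-1).
Proof. by rewrite /gamma_eq => /subr0_eq. Qed.

Lemma inv_expR1_bounds (R : realType) : 0 < (expR 1 : R)^-1 < 2^-1.
Proof.
rewrite invr_gt0 expR_gt0 ltf_pV2 ?posrE ?expR_gt0 //=.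
by have := @expR_gt1Dx R 1 (oner_neq0 _).
Qed.

Lemma inv_expR_lt (R : realType) (x y : R) : x < y -> (expR y)^-1 < (expR x)^-1.
Proof. by move=> xy; rewrite ltf_pV2 ?posrE ?expR_gt0// ltr_expR. Qed.

(** Let a = 1/e, s = exp(-x), t = exp(-y) for two solutions x < y. Cross-multiplying their equations
    gives (y - x)(1 - a + s)(1 - a + t) + (1 - 2a)(s - t) = 0, yet both terms are positive because a
    < 1/2 and t < s. *)
Lemma gamma_eq_unique (R : realType) (g h : R) :
  gamma_eq g -> gamma_eq h -> g = h.
Proof.
suff lt_absurd (x y : R) : gamma_eq x -> gamma_eq y -> x < y -> False.
  move=> eg eh; case: (ltgtP g h) => // gh; first by case: (lt_absurd g h).
  by case: (lt_absurd h g).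
move=> /gamma_eq_factor ex /gamma_eq_factor ey xy.
have /andP[a0 a2] := inv_expR1_bounds R.
have txy := inv_expR_lt xy.
have tx : 0 < (expR x)^-1 by rewrite invr_gt0 expR_gt0.
have ty : 0 < (expR y)^-1 by rewrite invr_gt0 expR_gt0.
move: ex ey a0 a2 tx ty txy.
move: (expR 1)^-1 (expR x)^-1 (expR y)^-1 => a s t ex ey a0 a2 s0 t0 ts.
have : (y - x) * ((1 - a + s) * (1 - a + t)) + (1 - 2 * a) * (s - t) = 0.
  have -> : (y - x) * ((1 - a + s) * (1 - a + t)) =
    ((y - 1) * (1 - a + t)) * (1 - a + s) - ((x - 1) * (1 - a + s)) * (1 - a + t)
    by ring.
  by rewrite -ex -ey; ring.
have : 0 < (y - x) * ((1 - a + s) * (1 - a + t)).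
  by apply: mulr_gt0; [lra | apply: mulr_gt0; lra].
have : 0 < (1 - 2 * a) * (s - t) by apply: mulr_gt0; lra.
lra.
Qed.

Lemma gamma_eq_exists (R : realType) : exists2 g : R, 1 < g < 2 & gamma_eq g.
Proof.
have /andP[a0 a2] := inv_expR1_bounds R.
pose f (g : R) := (expR 1)^-1 + (expR g)^-1
    - (g - 1) * (1 - (expR 1)^-1 + (expR g)^-1).
have t0 g : 0 < (expR g : R)^-1 by rewrite invr_gt0 expR_gt0.
have f1 : 0 < f 1 by rewrite /f subrr mul0r subr0; apply: addr_gt0.
(* At 2 the exponentials of 2 cancel, leaving 2/e - 1. *)
have f2 : f 2 < 0 by rewrite /f; lra.
have cf : {within `[1, 2], continuous f}%classic.
  apply: continuous_subspaceT => x.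
  have cN : {for x, continuous (fun g : R => (expR g)^-1)}.
    by apply: cvgV; [rewrite gt_eqF ?expR_gt0| exact: continuous_expR].
  apply: cvgB; first by apply: cvgD => //; exact: cvg_cst.
  apply: cvgM; first by apply: cvgB => //; exact: cvg_cst.
  by apply: cvgD => //; exact: cvg_cst.
have [||g /[!in_itv]/= /andP[g1 g2] fg] := @IVT R f 1 2 0 _ cf; first lra.
  by rewrite ge_min le_max (ltW f1) (ltW f2) orbT.
exists g => //; rewrite !lt_neqAle g1 g2 !andbT; apply/andP; split.
  by apply/eqP => e; move: f1; rewrite e fg ltxx.
by apply/eqP => e; move: f2; rewrite -e fg ltxx.
Qed.

(** Convexity: the tangent at the intermediate point [z] lies below the exponential at both [x] and
    [y], and averaging the two tangent values gives back [expR z]. *)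
Lemma expR_chord (R : realType) (x y t : R) : 0 <= t <= 1 ->
  expR ((1 - t) * x + t * y) <= (1 - t) * expR x + t * expR y.
Proof.
move=> /andP[t0 t1]; set z := _ + _.
have tangent u : expR z * (1 + (u - z)) <= expR u.
  have -> : expR u = expR z * expR (u - z) by rewrite -expRD; congr expR; ring.
  by rewrite ler_wpM2l ?expR_ge0 // expR_ge1Dx.
apply: le_trans (lerD (ler_wpM2l _ (tangent x)) (ler_wpM2l _ (tangent y)));
  last 2 first.
- lra.
- lra.
by rewrite le_eqVlt; apply/orP; left; apply/eqP; rewrite /z; ring.
Qed.

(** * Existence of an optimal LP solution *)

Section LPOptimum.
Variables (R : realType) (F C : finType) (I : ufl R F C).

(** A point (x, y) of the LP is encoded as a single function on a disjoint sum, so that Tychonoff's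
    theorem applies. *)
Let V : finType := (F * C + F)%type.
Let var (t : V) (v : prod_topology (fun _ : V => R)) : R := v t.
Let lpx (v : V -> R) (i : F) (j : C) := v (inl (i, j)).
Let lpy (v : V -> R) (i : F) := v (inr i).

Let continuous_sumR (T : topologicalType) (K : finType) (f : K -> T -> R) :
  (forall k, continuous (f k)) -> continuous (fun v => \sum_k f k v).
Proof.
by move=> cf; apply: continuous_big => [|k _]; [exact: add_continuous|exact: cf].
Qed.

Let continuous_var t : continuous (var t).
Proof. exact: proj_continuous. Qed.

Let continuous_scale (T : topologicalType) (c : R) (f : T -> R) :
  continuous f -> continuous (fun v => c * f v).
Proof. by move=> cf x; apply: cvgM; [exact: cvg_cst|exact: cf]. Qed.

Let continuous_plus (T : topologicalType) (f g : T -> R) :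
  continuous f -> continuous g -> continuous (fun v => f v + g v).
Proof. by move=> cf cg x; apply: cvgD; [exact: cf|exact: cg]. Qed.

Let cost (v : prod_topology (fun _ : V => R)) :=
  lp_ccost I (lpx v) + lp_fcost I (lpy v).

Let continuous_cost : continuous cost.
Proof.
apply: continuous_plus.
  apply: continuous_sumR => i; apply: continuous_sumR => j.
  exact: (continuous_scale (@continuous_var (inl (i, j)))).
apply: continuous_sumR => i.
exact: (continuous_scale (@continuous_var (inr i))).
Qed.

Let box : set (prod_topology (fun _ : V => R)) :=
  fun v => lp_feasible (lpx v) (lpy v) /\ forall t, v t <= 1.

Let compact_box : compact box.
Proof.
have cu : @compact (prod_topology (fun _ : V => R))
    (fun v => forall t, `[0, 1]%classic (v t)).
  apply: (@tychonoff V (fun _ => R) (fun _ => `[0, 1]%classic)) => t.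
  exact: segment_compact.
have clsum j : topology_structure.closed (fun v : prod_topology (fun _ : V => R) =>
    \sum_i lpx v i j = 1).
  apply: (@preimage_closed _ _ (fun v : prod_topology (fun _ : V => R) =>
    \sum_i lpx v i j) [set x | x = 1]%classic); last exact: closed_eq.
  move=> v _; apply: continuous_sumR => i.
  exact: (@continuous_var (inl (i, j))).
have clle i j : topology_structure.closed (fun v : prod_topology (fun _ : V => R) =>
    0 <= lpy v i + (- 1) * lpx v i j).
  apply: (@preimage_closed _ _ (fun v : prod_topology (fun _ : V => R) =>
    lpy v i + (- 1) * lpx v i j) [set x | 0 <= x]%classic); last exact: closed_ge.
  move=> v _; apply: continuous_plus; first exact: (@continuous_var (inr i)).
  exact: (continuous_scale (@continuous_var (inl (i, j)))).
have clA := @closed_bigI _ C [set: _]%classic _ (fun j _ => clsum j).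
have clB := @closed_bigI _ (F * C)%type [set: _]%classic _ (fun ij _ => clle ij.1 ij.2).
apply: (subclosed_compact _ cu); last first.
  move=> v [[_ _ x0 y0] v1] t; rewrite /= in_itv /= v1 andbT.
  by case: t => [[i j]|i]; [exact: x0|exact: y0].
suff -> : box = (\bigcap_(j in [set: _]) (fun v : prod_topology (fun _ : V => R) =>
    \sum_i lpx v i j = 1)%R `&` \bigcap_(ij in [set: _])
    (fun v : prod_topology (fun _ : V => R) =>
       (0 <= lpy v ij.1 + (- 1) * lpx v ij.1 ij.2)%R)
    `&` (fun v => forall t, `[0%R, 1%R] (v t)))%classic.
  apply: closedI; first exact: closedI.
  by apply: compact_closed => //; apply: hausdorff_product => t; exact: norm_hausdorff.
apply/funext => v; apply/propext; split.
  move=> [[s1 xy x0 y0] v1]; split; first split.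
  - by move=> j _; exact: s1.
  - by move=> [i j] _; rewrite mulN1r subr_ge0; exact: xy.
  - move=> t; rewrite /= in_itv /= v1 andbT.
    by case: t => [[i j]|i]; [exact: x0|exact: y0].
move=> [[s1 xy] v01].
have v0 t : 0 <= v t by have := v01 t; rewrite /= in_itv /= => /andP[].
split; last by move=> t; have := v01 t; rewrite /= in_itv /= => /andP[].
split.
- by move=> j; exact: s1.
- by move=> i j; have := xy (i, j) Logic.I; rewrite mulN1r subr_ge0.
- by move=> i j; exact: v0.
- by move=> i; exact: v0.
Qed.

Let vec (x : F -> C -> R) (y : F -> R) : V -> R :=
  fun t => match t with inl ij => x ij.1 ij.2 | inr i => Num.min (y i) 1 end.

Let vec_box x y : lp_feasible x y -> box (vec x y).
Proof.
move=> [s1 xy x0 y0].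
have x1 i j : x i j <= 1.
  by rewrite -(s1 j) (bigD1 i) //= lerDl; apply: sumr_ge0 => k _; exact: x0.
split; last by case=> [[i j]|i] /=; [exact: x1|rewrite ge_min lexx orbT].
split=> //= i; first by move=> j; rewrite /lpx /lpy /= le_min xy x1.
by rewrite /lpy /= le_min y0 ler01.
Qed.

(** Every feasible [x] is at most 1, so capping [y] at 1 preserves feasibility and does not raise
    the cost. A minimum over the compact [box] is therefore a minimum over all feasible points. *)
Lemma lp_optimal_exists :
  (exists x y, @lp_feasible R F C x y) -> exists x y, lp_optimal I x y.
Proof.
move=> [x0 [y0 feas0]].
have [||v vbox vmin] := @compact_EVT_min _ R cost box _ compact_box.
- by exists (vec x0 y0); exact: vec_box.
- by apply: continuous_subspaceT => v; exact: continuous_cost.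
move: vbox => /set_mem[vfeas v1].
exists (lpx v), (lpy v); split => // x y feas.
apply: le_trans (vmin (vec x y) _) _; first by apply/mem_set; exact: vec_box.
rewrite /cost lerD2l; apply: ler_sum => i _.
by rewrite ler_wpM2l ?fcost_ge0// /lpy /= ge_min lexx.
Qed.

End LPOptimum.

(** * Greedy assignment and splitting *)

Section Greedy.
Variables (R : realType) (F : finType) (y : F -> R).
Hypothesis y_ge0 : forall i, 0 <= y i.

Lemma greedy_ge0 s rem i : 0 <= rem -> 0 <= greedy y s rem i.
Proof.
elim: s rem => //= k s IHs rem rem0; case: eqP => _.
  by rewrite le_min y_ge0.
by apply: IHs; rewrite subr_ge0 ge_min lexx orbT.
Qed.

Lemma greedy_le s rem i : 0 <= rem -> greedy y s rem i <= y i.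
Proof.
elim: s rem => //= k s IHs rem rem0; case: eqP => [->|_].
  by rewrite ge_min lexx.
by apply: IHs; rewrite subr_ge0 ge_min lexx orbT.
Qed.

Lemma greedy0 s i : greedy y s 0 i = 0.
Proof.
elim: s => //= k s IHs.
by rewrite min_r ?y_ge0// subr0 IHs; case: ifP.
Qed.

Lemma greedy_sum s rem : uniq s -> 0 <= rem <= \sum_(i <- s) y i ->
  \sum_(i <- s) greedy y s rem i = rem.
Proof.
elim: s rem => [|k s IHs] rem /=.
  by rewrite !big_nil -eq_le => _ /eqP.
move=> /andP[ks us]; rewrite !big_cons eqxx => /andP[rem0 remle].
rewrite (eq_big_seq (greedy y s (rem - Num.min (y k) rem))); last first.
  by move=> i si; case: eqP si ks => // -> ->.
rewrite IHs ?subrKC// subr_ge0 ge_min lexx orbT /=.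
case: (leP (y k) rem) => _; first by rewrite lerBlDl.
by rewrite subrr; apply: sumr_ge0.
Qed.

(** The threshold is the cost of the facility at which the demand runs out. *)
Lemma greedy_threshold (c : F -> R) s rem : 0 <= rem ->
  sorted (fun i i' => c i <= c i') s -> exists tau, forall i, i \in s ->
  (0 < greedy y s rem i -> c i <= tau) /\ (greedy y s rem i < y i -> tau <= c i).
Proof.
move=> rem0 srt.
(* The lower bound [m] is added for the induction: a saturated head [k] needs its own cost to be at
   most the threshold found in the tail. *)
suff gen : forall m, all (fun i => m <= c i) s -> exists2 tau, m <= tau &
    forall i, i \in s -> (0 < greedy y s rem i -> c i <= tau) /\
      (greedy y s rem i < y i -> tau <= c i).
- case: s srt rem0 gen => [|k s] srt rem0 gen; first by exists 0.
  have [|tau _ H] := gen (c k); last by exists tau.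
  rewrite /= lexx; apply: (order_path_min (leT := fun i i' => c i <= c i')) => //.
  by move=> ? ? ?; exact: le_trans.
elim: s rem rem0 srt => [|k s IHs] rem rem0 /=; first by move=> _ m _; exists m.
move=> pth m /andP[mk ms].
have ks : all (fun i => c k <= c i) s.
  apply: (order_path_min (leT := fun i i' => c i <= c i')) => //.
  by move=> ? ? ?; exact: le_trans.
case: leP => [yk|yk].
  have [|tau ktau H] := IHs (rem - y k) _ (path_sorted pth) (c k) ks.
    by rewrite subr_ge0.
  exists tau => [|i]; first exact: le_trans ktau.
  by rewrite inE; case: eqP => [->|_] //= ?; [rewrite ltxx|apply: H].
exists (c k) => // i; rewrite inE subrr greedy0; case: eqP => [->|_] //= si.
by rewrite ltxx; split => // _; apply: (allP ks).
Qed.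

End Greedy.

(** * Splitting copies until the solution is complete *)

Section Splitting.
Variables (R : realType) (F C : finType) (I : ufl R F C).
Implicit Types (k : copy R F C) (s : seq (copy R F C)).

Definition copy_bounded k : bool :=
  (0 <= cp_open k) && [forall j, 0 <= cp_conn k j <= cp_open k].

(* [tau j] separates the facilities that serve [j] from those that could still
   serve more of it. *)
Definition copy_greedy (tau : C -> R) k : bool := [forall j,
  ((0 < cp_conn k j) ==> (ccost I (cp_fac k) j <= tau j)) &&
  ((cp_conn k j < cp_open k) ==> (tau j <= ccost I (cp_fac k) j))].

Lemma splits_bounded s s' : splits_to s s' ->
  all copy_bounded s -> all copy_bounded s'.
Proof.
elim=> // s1 k k1 k2 s2 {}s' j /andP[kj0 kj1] [_ o1 o2 _ sp] _ IH.
rewrite !all_cat /= in IH *.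
move=> /and3P[b1 bk b2]; apply: IH; rewrite b1 b2 !andbT /=.
rewrite /copy_bounded o1 o2 (ltW kj0) subr_ge0 (ltW kj1) /= -o2 -o1.
by apply/andP; split; apply/forallP => j'; have [] := sp j'.
Qed.

(** A client served by a part is served by the whole; a client that does not saturate a part does
    not saturate the whole, since the other part carries at most its opening. *)
Lemma splits_greedy tau s s' : splits_to s s' ->
  all (copy_greedy tau) s -> all (copy_greedy tau) s'.
Proof.
elim=> // s1 k k1 k2 s2 {}s' j _ [[f1 f2] o1 o2 _ sp] _ IH.
rewrite !all_cat /= in IH *.
move=> /and3P[b1 /forallP bk b2]; apply: IH; rewrite b1 b2 !andbT /=.
apply/andP; split; apply/forallP => j'; have [e /andP[? ?] /andP[? ?]] := sp j';
  have /andP[/implyP ck /implyP ck'] := bk j'; rewrite ?f1 ?f2;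
  by apply/andP; split; apply/implyP => ?; [apply: ck|apply: ck']; lra.
Qed.

Lemma splits_sum_open s s' i : splits_to s s' ->
  \sum_(k <- s | cp_fac k == i) cp_open k =
  \sum_(k <- s' | cp_fac k == i) cp_open k.
Proof.
elim=> // s1 k k1 k2 s2 {}s' j _ [[f1 f2] o1 o2 _ _] _ <-.
rewrite !big_cat !big_cons f1 f2; congr (_ + _); case: (cp_fac k == i) => //.
by rewrite /= addrA o1 o2 subrKC.
Qed.

Lemma splits_sum_conn s s' j : splits_to s s' ->
  \sum_(k <- s) cp_conn k j = \sum_(k <- s') cp_conn k j.
Proof.
elim=> // s1 k k1 k2 s2 {}s' j' _ [_ _ _ _ sp] _ <-.
rewrite !big_cat !big_cons; congr (_ + _).
by rewrite /= addrA; have [-> _ _] := sp j.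
Qed.

Definition fractional k : {set C} := [set j | 0 < cp_conn k j < cp_open k].

(** Each client fills the first copy before using the second, so it is fractional in at most one of
    them. *)
Definition split_first (j : C) k : copy R F C := Copy (cp_fac k) (cp_conn k j)
  (fun j' => Num.min (cp_conn k j') (cp_conn k j)).
Definition split_second (j : C) k : copy R F C :=
  Copy (cp_fac k) (cp_open k - cp_conn k j)
  (fun j' => cp_conn k j' - Num.min (cp_conn k j') (cp_conn k j)).

Lemma is_split_first_second j k : copy_bounded k ->
  is_split j k (split_first j k) (split_second j k).
Proof.
move=> /andP[_ /forallP bk]; split => //=; first by rewrite minxx.
move=> j'; have /andP[? ?] := bk j; have /andP[? ?] := bk j'.
by split; case: (leP (cp_conn k j') (cp_conn k j)) => ?; lra.
Qed.

(** The fractional clients of the two parts form disjoint subsets of those of [k], and both miss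
    [j], which saturates the first part and leaves the second empty. *)
Lemma fractional_split j k : copy_bounded k -> j \in fractional k ->
  (#|fractional (split_first j k)| + #|fractional (split_second j k)|
    < #|fractional k|)%N.
Proof.
move=> /andP[_ /forallP bk] jk.
rewrite -[leqLHS]addn1 addnC.
have dis : fractional (split_first j k) :&: fractional (split_second j k) = set0.
  apply/setP => j'; rewrite !inE /=.
  apply/negbTE; case: (leP (cp_conn k j') (cp_conn k j)) => _.
    by rewrite subrr ltxx andbF.
  by rewrite ltxx andbF.
have := cardsUI (fractional (split_first j k)) (fractional (split_second j k)).
rewrite dis cards0 addn0 => <-; rewrite addnC addn1.
apply: proper_card; apply/properP; split.
  apply/subsetP => j'; move: jk; rewrite !inE /=; have /andP[? ?] := bk j'.
  by case: (leP (cp_conn k j') (cp_conn k j)) => ? /andP[? ?] /orP[] /andP[? ?];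
    lra.
by exists j => //; rewrite !inE /= minxx subrr !ltxx andbF.
Qed.

(** Splitting terminates because the number of fractional pairs of a copy and a client strictly
    decreases. *)
Lemma complete_split_exists s : all copy_bounded s ->
  exists2 s', splits_to s s' & complete_sol s'.
Proof.
have [n] := ubnP (\sum_(k <- s) #|fractional k|).
elim: n s => // n IHn s; rewrite ltnS => szn bs.
have [/all_tnthP frac0|] := boolP (all (fun k => fractional k == set0) (in_tuple s)).
  exists s; first exact: splits_refl.
  rewrite /complete_sol /= => k j; apply/negP => kj; have /eqP := frac0 k.
  by move/setP/(_ j); rewrite !inE kj.
rewrite -has_predC /= => hs; move: szn bs.
case: (split_find hs) => k s1 s2 + _.
rewrite -cats1 -catA /= => /set0Pn[j jk]; rewrite big_cat big_cons all_cat /=.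
move=> szn /and3P[b1 bk b2].
have [||s' ss' cs'] := IHn (s1 ++ split_first j k :: split_second j k :: s2).
- rewrite big_cat !big_cons; apply: leq_trans szn.
  rewrite /= ltn_add2l addnA ltn_add2r; exact: fractional_split.
- apply: (splits_bounded _ (_ : all copy_bounded (s1 ++ k :: s2))); last first.
    by rewrite all_cat /= b1 bk b2.
  apply: splits_step (is_split_first_second j bk) (splits_refl _).
  by move: jk; rewrite inE.
exists s' => //; apply: splits_step (is_split_first_second j bk) ss'.
by move: jk; rewrite inE.
Qed.

End Splitting.

(** * Existence of a run of the algorithm *)

Section Existence.
Variables (R : realType) (F C : finType) (I : ufl R F C).

Lemma nearest_order_exists (j : C) : exists s, nearest_order I j s.
Proof.
pose le (i i' : F) := ccost I i j <= ccost I i' j.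
exists (sort le (enum F)); split; first by rewrite perm_sort.
by apply: sort_sorted => i i'; exact: le_total.
Qed.

Lemma clustering_exists gamma (s : seq (copy R F C)) U :
  exists cs, clustering I gamma s U cs.
Proof.
have [n] := ubnP #|U|; elim: n U => // n IHn U; rewrite ltnS => Un.
have [->|/set0Pn[j0 j0U]] := eqVneq U set0; first by exists [::]; constructor.
pose D j := Dav I gamma s j + Dmax I s j.
case: (arg_minP D j0U) => j; rewrite -/(j \in U) => jU jmin.
have [|cs Hcs] := IHn (U :\: [set j' in U | (j' == j) || neighbors s j j']).
  apply: leq_trans Un; apply: proper_card; apply/properP; split.
    exact: subsetDl.
  by exists j => //; rewrite !inE eqxx jU.
by exists (j :: cs); apply: clustering_cons.
Qed.

Lemma closest_open_exists (s : seq (copy R F C)) cs (w : outcome s cs)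
    (j : C) (i0 : F) :
  exists i, closest_open I w j i.
Proof.
have [E|/set0Pn[i1 i1o]] := eqVneq (opened w) set0.
  by exists i0; rewrite /closest_open E eqxx.
case: (arg_minP (fun i => ccost I i j) i1o) => i io imin.
by exists i.
Qed.

Lemma init_copies_bounded (yt : F -> R) (ord : C -> seq F) :
  (forall i, 0 <= yt i) -> all (@copy_bounded R F C) (init_copies yt ord).
Proof.
move=> y0; rewrite all_map; apply/allP => i _.
rewrite /= /copy_bounded /= y0; apply/forallP => j /=.
by rewrite greedy_ge0 ?greedy_le.
Qed.

Lemma A1_run_exists gamma : 0 < gamma ->
  (exists s : solution F C, sol_feasible s) -> exists r : run R F C, A1_run I gamma r.
Proof.
move=> g0 [sol _].
have [|x [y opt]] := @lp_optimal_exists R F C I.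
  (* The LP is feasible: connect as in the given solution and open every facility fully. *)
  exists (fun i j => (i == sol_conn sol j)%:R), (fun _ => 1).
  split=> [j|i j|i j|_]; rewrite ?ler0n ?ler01 ?lern1 ?leq_b1 //.
  rewrite (bigD1 (sol_conn sol j)) //= eqxx big1 ?addr0 // => i /negPf->.
  by [].
have [ord Hord] := choice nearest_order_exists.
have [_ _ _ y0] := opt.1.
have [|s Hs sc] := @complete_split_exists R F C
  (init_copies (fun i => gamma * y i) ord).
  by apply: init_copies_bounded => i; rewrite mulr_ge0 // ltW.
have [cs Hcs] := clustering_exists gamma s [set: C].
(* [sol_conn sol] only provides a value for outcomes in which nothing is open. *)
have [conn Hconn] := choice (fun wj : outcome s cs * C =>
  closest_open_exists wj.1 wj.2 (sol_conn sol wj.2)).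
exists (Run x y ord (fun w j => conn (w, j))); split => //= w j.
exact: (Hconn (w, j)).
Qed.

End Existence.

(** * Masses and distances of the copies after splitting *)

Section SplitCopies.
Variables (R : realType) (F C : finType) (I : ufl R F C) (gamma : R).
Variables (x : F -> C -> R) (y : F -> R) (ord : C -> seq F) (s : seq (copy R F C)).
Hypotheses (gamma_ge1 : 1 <= gamma) (feas : lp_feasible x y).
Hypothesis ordP : forall j, nearest_order I j (ord j).
Hypothesis splitP : splits_to (init_copies (fun i => gamma * y i) ord) s.

Let gy_ge0 i : 0 <= gamma * y i.
Proof. by have [_ _ _ y0] := feas; rewrite mulr_ge0 // (le_trans ler01). Qed.

Let bounded (k : 'I_(size s)) : copy_bounded (tnth (in_tuple s) k).
Proof.
have := splits_bounded splitP (init_copies_bounded ord gy_ge0).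
by move=> /(all_tnthP (t := in_tuple s))/(_ k).
Qed.

Lemma ybar_ge0 (k : 'I_(size s)) : 0 <= ybar k.
Proof. by have /andP[] := bounded k. Qed.

Lemma xbar_bounds (k : 'I_(size s)) j : 0 <= xbar k j <= ybar k.
Proof. by have /andP[_ /forallP/(_ j)] := bounded k. Qed.

Lemma sum_ybar i : \sum_(k < size s | fac k == i) ybar k = gamma * y i.
Proof.
rewrite -(big_tnth _ _ s (fun k => cp_fac k == i) (@cp_open R F C)).
rewrite -(splits_sum_open i splitP) big_map /=.
rewrite -big_filter (_ : [seq i' <- enum F | i' == i] = [:: i]) ?big_seq1 //.
by rewrite -[RHS](filter_pred1_uniq (enum_uniq F)) ?mem_enum.
Qed.

Lemma sum_xbar j : \sum_(k < size s) xbar k j = 1.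
Proof.
rewrite -(big_tnth _ _ s predT (fun k => cp_conn k j)).
rewrite -(splits_sum_conn j splitP) big_map /=.
have [pj _] := ordP j.
rewrite -(perm_big _ pj) /= greedy_sum // ?(perm_uniq pj) ?enum_uniq // ler01 /=.
rewrite (perm_big _ pj) /= big_enum /=.
(* The scaled openings suffice for a full unit of demand: [x i j <= y i <= gamma * y i], and the
   left sides add up to 1. *)
have [sx xy _ _] := feas; rewrite -(sx j); apply: ler_sum => i _.
by apply: le_trans (xy i j) _; rewrite ler_peMl //; have [_ _ _] := feas; apply.
Qed.

(** The greedy threshold of [j] separates the two costs before splitting, and splitting preserves
    it. *)
Lemma xbar_nearest (k k' : 'I_(size s)) j : 0 < xbar k j -> xbar k' j < ybar k' ->
  ccost I (fac k) j <= ccost I (fac k') j.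
Proof.
have thr j' : exists tau, forall i,
  (0 < greedy (fun i => gamma * y i) (ord j') 1 i -> ccost I i j' <= tau) /\
  (greedy (fun i => gamma * y i) (ord j') 1 i < gamma * y i -> tau <= ccost I i j').
  have [pj srt] := ordP j'.
  have [tau H] := greedy_threshold gy_ge0 ler01 srt.
  by exists tau => i; apply: H; rewrite (perm_mem pj) mem_enum.
have [tau Htau] := choice thr.
have /(splits_greedy splitP) :
    all (copy_greedy I tau) (init_copies (fun i => gamma * y i) ord).
  rewrite all_map; apply/allP => i _ /=; apply/forallP => j' /=.
  by have [a b] := Htau j' i; apply/andP; split; apply/implyP.
move=> /(all_tnthP (t := in_tuple s)) H xk xk'.
have /forallP/(_ j)/andP[/implyP/(_ xk) a _] := H k.
have /forallP/(_ j)/andP[_ /implyP/(_ xk') b] := H k'.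
exact: le_trans b.
Qed.

End SplitCopies.

(** * Expectation over the random choices *)

Section Expectation.
Variables (R : realType) (F C : finType) (s : seq (copy R F C)) (cs : seq C).
Let K := 'I_(size s).
Implicit Types (X Y : outcome s cs -> R) (w : outcome s cs).
Hypothesis ybar_ge0 : forall k : K, 0 <= ybar k.
Hypothesis xbarP : forall (k : K) j, 0 <= xbar k j <= ybar k.

Lemma xbar_ge0 (k : K) j : 0 <= xbar k j.
Proof. by have /andP[] := xbarP k j. Qed.

Lemma coin_bounds (k : K) : 0 <= coin k <= 1.
Proof.
by rewrite /coin ge_min lexx le_min ler01 ybar_ge0.
Qed.

(** Independence of all choices and coins, obtained by distributing the product of sums over all
    outcomes. *)
Lemma expectation_prod (phi : 'I_(size cs) -> K -> R) (psi : K -> bool -> R) :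
  expectation (fun w : outcome s cs =>
    (\prod_t phi t (w.1 t)) * \prod_k psi k (k \in w.2)) =
  (\prod_t \sum_k xbar k (tnth (in_tuple cs) t) * phi t k) *
  \prod_(k : K) (coin k * psi k true + (1 - coin k) * psi k false).
Proof.
rewrite bigA_distr_bigA /= bigA_distr big_distrlr /= /expectation.
rewrite (reindex_onto (fun w : outcome s cs => (w.1, w.2)) (fun w => w)) /=;
  last by case.
rewrite pair_big /=; apply: eq_big => [[f A]|[f A] _] /=; first by rewrite eqxx.
rewrite /prob /= mulrACA -!big_split /=; congr (_ * _).
by apply: eq_bigr => k _; case: (k \in A).
Qed.

Lemma prob_ge0 w : 0 <= prob w.
Proof.
rewrite /prob mulr_ge0 //; apply: prodr_ge0 => k _; first exact: xbar_ge0.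
by have /andP[? ?] := coin_bounds k; case: ifP => _; rewrite ?subr_ge0.
Qed.

Lemma expectation_le X Y : (forall w, X w <= Y w) ->
  expectation X <= expectation Y.
Proof.
by move=> XY; apply: ler_sum => w _; rewrite ler_wpM2l // (prob_ge0).
Qed.

Lemma expectationD X Y :
  expectation (fun w => X w + Y w) = expectation X + expectation Y.
Proof. by rewrite -big_split; apply: eq_bigr => w _; rewrite /= mulrDr. Qed.

Lemma expectationB X Y :
  expectation (fun w => X w - Y w) = expectation X - expectation Y.
Proof. by rewrite -sumrB; apply: eq_bigr => w _; rewrite mulrBr. Qed.

Lemma expectationZ a X : expectation (fun w => a * X w) = a * expectation X.
Proof. by rewrite mulr_sumr; apply: eq_bigr => w _; rewrite mulrCA. Qed.

Lemma expectation_sum (T : Type) (r : seq T) (P : pred T) (X : T -> outcome s cs -> R) :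
  expectation (fun w => \sum_(i <- r | P i) X i w) =
  \sum_(i <- r | P i) expectation (X i).
Proof.
by rewrite exchange_big /=; apply: eq_bigr => w _; rewrite mulr_sumr.
Qed.

End Expectation.

(** * Properties of the cluster centers *)

Section Clusters.
Variables (R : realType) (F C : finType) (I : ufl R F C) (gamma : R).
Variable s : seq (copy R F C).
Let K := 'I_(size s).
Hypothesis xbarP : forall (k : K) j, 0 <= xbar k j <= ybar k.

Lemma clustering_subset U cs : clustering I gamma s U cs -> {subset cs <= U}.
Proof.
elim=> // {}U j {}cs jU _ _ IH j'; rewrite inE => /predU1P[->//|/IH].
by rewrite inE => /andP[].
Qed.

(** Choosing a center removes all its neighbors, so a copy is close to at most one center and the
    sum has at most one nonzero term. *)
Lemma clustering_sum_xbar U cs (k : K) : 0 <= ybar k ->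
  clustering I gamma s U cs -> \sum_(j <- cs) xbar k j <= ybar k.
Proof.
move=> yk0; elim=> [|{}U j {}cs jU _ Hcs IH]; first by rewrite big_nil.
rewrite big_cons; have /andP[] := xbarP k j.
rewrite le_eqVlt => /predU1P[<- _|xkj xk]; first by rewrite add0r.
rewrite big1_seq ?addr0 // => j' /andP[_ /(clustering_subset Hcs)].
rewrite !inE negb_and negb_or => /andP[+ j'U]; rewrite j'U /= => /andP[_].
move=> /existsPn/(_ k); rewrite !inE xkj /= -leNgt => xkj'.
by apply/eqP; rewrite eq_le xkj'; have /andP[] := xbarP k j'.
Qed.

(** The center sought is the one whose cluster removes [j]: at its selection [j] was still a
    candidate, so it minimizes against [j]. If [j] is itself that center, a close copy makes it its
    own neighbor. *)
Lemma clustering_center U cs j : clustering I gamma s U cs -> j \in U ->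
  close s j != set0 -> exists t : 'I_(size cs), let j' := tnth (in_tuple cs) t in
  neighbors s j' j /\
  Dav I gamma s j' + Dmax I s j' <= Dav I gamma s j + Dmax I s j.
Proof.
move=> Hcs + cj; elim: Hcs => [|{}U j' {}cs jU jmin Hcs IH]; first by rewrite inE.
move=> jU'; have [nj|nj] := boolP ((j == j') || neighbors s j' j).
  exists ord0; rewrite /= (tnth_nth j) /=; split; last exact: jmin.
  case/orP: nj => // /eqP <-; have /set0Pn[k kj] := cj.
  by apply/existsP; exists k; rewrite inE kj.
have [|t] := IH; first by rewrite !inE jU' andbT negb_and nj orbT.
rewrite (tnth_nth j) => Ht; exists (lift ord0 t).
by rewrite (tnth_nth j).
Qed.

End Clusters.

(** * Probability that all copies of a thinned set stay closed *)

Section Survival.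
Variables (R : realType) (F C : finType) (s : seq (copy R F C)) (cs : seq C).
Let K := 'I_(size s).
Implicit Types (w : outcome s cs) (rho : K -> R).
Hypothesis ybar_ge0 : forall k : K, 0 <= ybar k.
Hypothesis xbarP : forall (k : K) j, 0 <= xbar k j <= ybar k.
Hypothesis sum_xbar : forall j, \sum_(k < size s) xbar k j = 1.
Hypothesis complete : complete_sol s.

Lemma close_xbar (k : K) j : 0 < xbar k j -> xbar k j = ybar k.
Proof.
move=> xk; have := complete k j; rewrite xk /= -leNgt => yx.
by apply/eqP; rewrite eq_le yx andbT; have /andP[] := xbarP k j.
Qed.

(* The probability, given the outcome [w], that no copy survives a thinning that
   discards each open copy [k] with probability [1 - rho k]. *)
Definition survival rho w : R := (\prod_t (1 - rho (w.1 t))) *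
  \prod_(k : K) (1 - ((k \in w.2) && (k \notin clustered s cs))%:R * rho k).

Definition missed rho j : R := \sum_(k : K) xbar k j * (1 - rho k).

Let flips rho : R :=
  \prod_(k : K) (1 - (k \notin clustered s cs)%:R * (coin k * rho k)).

Let flipsE rho : flips rho = \prod_(k : K)
  (coin k * (1 - (true && (k \notin clustered s cs))%:R * rho k) +
  (1 - coin k) * (1 - (false && (k \notin clustered s cs))%:R * rho k)).
Proof. by apply: eq_bigr => k _ /=; case: (k \in clustered s cs) => /=; ring. Qed.

Lemma expectation_survival rho :
  expectation (survival rho) =
  (\prod_t missed rho (tnth (in_tuple cs) t)) * flips rho.
Proof.
rewrite flipsE -(expectation_prod (s := s) (cs := cs) (fun _ k => 1 - rho k)
  (fun k b => 1 - (b && (k \notin clustered s cs))%:R * rho k)).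
by [].
Qed.

(** A weight depending only on the choice for [t] alters only the factor of [t] in the product
    formula; the other factors are common to both sides and nonnegative. *)
Lemma expectation_survival_center rho (t : 'I_(size cs)) (g : K -> R) (b : R) :
  (forall k, 0 <= rho k <= 1) ->
  \sum_(k : K) xbar k (tnth (in_tuple cs) t) * (1 - rho k) * g k <=
    b * missed rho (tnth (in_tuple cs) t) ->
  expectation (fun w => survival rho w * g (w.1 t)) <= b * expectation (survival rho).
Proof.
move=> rho01 Hb.
have [m0 f0] : (forall j, 0 <= missed rho j) /\ 0 <= flips rho.
  split=> [j|]; first apply: sumr_ge0 => k _.
    have /andP[? _] := xbarP k j; have /andP[_ ?] := rho01 k.
    by rewrite mulr_ge0 // subr_ge0.
  apply: prodr_ge0 => k _; rewrite subr_ge0.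
  have /andP[? ?] := rho01 k; have /andP[? ?] := coin_bounds ybar_ge0 k.
  by case: (k \in _) => /=; rewrite ?mul0r ?mul1r // mulr_ile1.
pose phi t' k := (1 - rho k) * (if t' == t then g k else 1).
have -> : expectation (fun w => survival rho w * g (w.1 t)) =
    (\prod_t' \sum_k xbar k (tnth (in_tuple cs) t') * phi t' k) * flips rho.
  rewrite flipsE -(expectation_prod (s := s) (cs := cs) phi
    (fun k b => 1 - (b && (k \notin clustered s cs))%:R * rho k)).
  apply: eq_bigr => w _; congr (_ * _); rewrite /survival mulrAC; congr (_ * _).
  by rewrite big_split /= -big_mkcond /= big_pred1_eq.
rewrite expectation_survival mulrA; apply: ler_wpM2r => //.
rewrite (bigD1 t) //= [in leRHS](bigD1 t) //= mulrA.
have -> : \prod_(i < size cs | i != t)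
    (\sum_k xbar k (tnth (in_tuple cs) i) * phi i k) =
    \prod_(i < size cs | i != t) missed rho (tnth (in_tuple cs) i).
  apply: eq_bigr => i /negPf it; apply: eq_bigr => k _.
  by rewrite /phi it mulr1.
apply: ler_wpM2r; first by apply: prodr_ge0 => i _; exact: m0.
apply: le_trans Hb; rewrite le_eqVlt; apply/orP; left; apply/eqP.
by apply: eq_bigr => k _; rewrite /phi eqxx mulrA.
Qed.

(** Each factor has the form 1 - u and is at most exp(-u). It remains to see that every copy
    contributes at least [coin k * rho k] to the exponent, through its coin or through a center. *)
Lemma expectation_survival_le rho : (forall k, 0 <= rho k <= 1) ->
  expectation (survival rho) <= expR (- \sum_(k : K) coin k * rho k).
Proof.
move=> rho01; rewrite expectation_survival.
have coin01 := coin_bounds ybar_ge0.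
have ineq (u : R) : 1 - u <= expR (- u) by exact: expR_ge1Dx.
have missedE j : missed rho j = 1 - \sum_(k : K) xbar k j * rho k.
  rewrite -(sum_xbar j) -sumrB; apply: eq_bigr => k _; ring.
apply: (@le_trans _ _
  ((\prod_t expR (- \sum_(k : K) xbar k (tnth (in_tuple cs) t) * rho k)) *
   \prod_(k : K) expR (- ((k \notin clustered s cs)%:R * (coin k * rho k))))).
  apply: ler_pM.
  - apply: prodr_ge0 => t _; apply: sumr_ge0 => k _.
    have /andP[? _] := xbarP k (tnth (in_tuple cs) t); have /andP[_ ?] := rho01 k.
    by rewrite mulr_ge0 // subr_ge0.
  - apply: prodr_ge0 => k _; rewrite subr_ge0.
    have /andP[? ?] := rho01 k; have /andP[? ?] := coin01 k.
    by case: (k \in _) => /=; rewrite ?mul0r ?mul1r // mulr_ile1.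
  - apply: ler_prod => t _; rewrite missedE ineq andbT -missedE.
    apply: sumr_ge0 => k _.
    have /andP[? _] := xbarP k (tnth (in_tuple cs) t); have /andP[_ ?] := rho01 k.
    by rewrite mulr_ge0 // subr_ge0.
  - apply: ler_prod => k _; rewrite ineq andbT subr_ge0.
    have /andP[? ?] := rho01 k; have /andP[? ?] := coin01 k.
    by case: (k \in _) => /=; rewrite ?mul0r ?mul1r // mulr_ile1.
rewrite -!expR_sum -expRD ler_expR !sumrN -opprD lerN2 exchange_big /= -big_split.
apply: ler_sum => k _ /=; have /andP[r0 r1] := rho01 k.
have tk0 : 0 <= \sum_(t < size cs) xbar k (tnth (in_tuple cs) t) * rho k.
  apply: sumr_ge0 => t _; rewrite mulr_ge0 //.
  by have /andP[] := xbarP k (tnth (in_tuple cs) t).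
have [|_] := boolP (k \in clustered s cs); last by rewrite mul1r lerDr.
(* The coin of a clustered copy is ignored, but completeness makes its mass for the center [t] equal
   to [ybar k], which is at least [coin k]. *)
rewrite inE mul0r addr0 => /(has_tnthP (t := in_tuple cs))[t]; rewrite inE => kt.
rewrite (bigD1 t) //=; apply: le_trans (_ : xbar k (tnth (in_tuple cs) t) * rho k <= _).
  by rewrite ler_wpM2r // close_xbar // ge_min lexx orbT.
rewrite lerDl; apply: sumr_ge0 => i _; rewrite mulr_ge0 //.
by have /andP[] := xbarP k (tnth (in_tuple cs) i).
Qed.

End Survival.

(** * Expected opening cost *)

Section FacilityCost.
Variables (R : realType) (F C : finType) (s : seq (copy R F C)) (cs : seq C).
Let K := 'I_(size s).
Implicit Types w : outcome s cs.
Hypothesis ybar_ge0 : forall k : K, 0 <= ybar k.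
Hypothesis xbarP : forall (k : K) j, 0 <= xbar k j <= ybar k.
Hypothesis sum_xbar : forall j, \sum_(k < size s) xbar k j = 1.

Lemma expectation_chosen (t : 'I_(size cs)) (k : K) :
  expectation (fun w : outcome s cs => (w.1 t == k)%:R) = xbar k (tnth (in_tuple cs) t).
Proof.
pose phi t' k' : R := if t' == t then (k' == k)%:R else 1.
transitivity (expectation (fun w : outcome s cs =>
    (\prod_t' phi t' (w.1 t')) * \prod_(k' : K) 1)).
  apply: eq_bigr => w _; congr (_ * _).
  by rewrite [X in _ * X]big1 // mulr1 -big_mkcond big_pred1_eq.
rewrite (expectation_prod phi (fun _ _ => 1)).
rewrite [X in _ * X]big1 => [|k' _]; last by ring.
rewrite mulr1 (bigD1 t) //= [X in _ * X]big1 => [|t' /negPf t't]; last first.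
  by rewrite /phi t't -[RHS](sum_xbar (tnth (in_tuple cs) t')); apply: eq_bigr => k' _;
    rewrite mulr1.
rewrite mulr1 (bigD1 k) //= /phi !eqxx mulr1 big1 ?addr0 // => k' /negPf->.
by rewrite mulr0.
Qed.

Lemma expectation_coin (k : K) :
  expectation (fun w : outcome s cs => (k \in w.2)%:R) = coin k.
Proof.
pose psi k' (b : bool) : R := if k' == k then b%:R else 1.
transitivity (expectation (fun w : outcome s cs =>
    (\prod_(t < size cs) 1) * \prod_(k' : K) psi k' (k' \in w.2))).
  apply: eq_bigr => w _; congr (_ * _).
  by rewrite [X in X * _]big1 // mul1r -big_mkcond big_pred1_eq.
rewrite (expectation_prod (fun _ _ => 1) psi).
rewrite [X in X * _]big1 => [|t' _]; last first.
  by rewrite -[RHS](sum_xbar (tnth (in_tuple cs) t')); apply: eq_bigr => k' _;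
    rewrite mulr1.
rewrite mul1r (bigD1 k) //= big1 => [|k' /negPf k'k]; last by rewrite /psi k'k /=; ring.
by rewrite /psi !eqxx /=; ring.
Qed.

(** A union bound: an open facility is charged to each of its open copies, and a copy to each event
    that opens it. *)
Lemma sum_opened_le (f : F -> R) w : (forall i, 0 <= f i) ->
  \sum_(i in opened w) f i <= \sum_(k : K) f (fac k) *
    (\sum_t (w.1 t == k)%:R + (k \notin clustered s cs)%:R * (k \in w.2)%:R).
Proof.
move=> f0; apply: (@le_trans _ _ (\sum_(k in opened_copies w) f (fac k))).
  rewrite (partition_big_imset (@fac _ _ _ s)) /=; apply: ler_sum => i /imsetP[k kw ->].
  rewrite (bigD1 k) /=; last by rewrite kw eqxx.
  by rewrite lerDl; apply: sumr_ge0.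
rewrite big_mkcond; apply: ler_sum => k _.
have n0 : 0 <= \sum_t (w.1 t == k)%:R :> R by apply: sumr_ge0 => t _; rewrite ler0n.
case: ifP => [|_]; last by rewrite mulr_ge0 // addr_ge0 // mulr_ge0 ?ler0n.
rewrite /opened_copies inE => /orP[/imsetP[t _ kt]|].
  rewrite ler_peMr // (bigD1 t) //= -kt eqxx -addrA lerDl addr_ge0 //.
    by apply: sumr_ge0 => ? _; rewrite ler0n.
  by rewrite mulr_ge0 ?ler0n.
by rewrite in_setD => /andP[-> ->]; rewrite mulr1 ler_peMr // lerDr.
Qed.

(** A clustered copy is opened by the centers with total probability at most [ybar k]; an
    unclustered one has mass 0 for every center and is opened by its coin alone. *)
Lemma expectation_facility_le (f : F -> R) : (forall i, 0 <= f i) ->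
  (forall k : K, \sum_(j <- cs) xbar k j <= ybar k) ->
  expectation (fun w : outcome s cs => \sum_(i in opened w) f i) <=
  \sum_(k : K) f (fac k) * ybar k.
Proof.
move=> f0 cl.
apply: le_trans (expectation_le ybar_ge0 xbarP (fun w => sum_opened_le w f0)) _.
rewrite expectation_sum; apply: ler_sum => k _; rewrite expectationZ ler_wpM2l //.
rewrite expectationD expectationZ expectation_coin expectation_sum.
rewrite (eq_bigr _ (fun t _ => expectation_chosen t k)).
rewrite -(big_tnth _ _ cs predT (xbar k)).
have [_|kc] := boolP (k \in clustered s cs); first by rewrite mul0r addr0.
rewrite mul1r big1_seq ?add0r ?ge_min ?lexx ?orbT // => j /andP[_ jcs].
apply/eqP; rewrite eq_le; have /andP[-> _] := xbarP k j; rewrite andbT leNgt.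
by apply: contra kc => kj; rewrite inE; apply/hasP; exists j => //; rewrite inE.
Qed.

End FacilityCost.

(** * Expected connection cost along a sorted list of copies *)

Section ConnectionCost.
Variables (R : realType) (F C : finType) (s : seq (copy R F C)) (cs : seq C).
Let K := 'I_(size s).
Implicit Types (w : outcome s cs) (rho : K -> R).
Hypothesis ybar_ge0 : forall k : K, 0 <= ybar k.
Hypothesis xbarP : forall (k : K) j, 0 <= xbar k j <= ybar k.
Hypothesis sum_xbar : forall j, \sum_(k < size s) xbar k j = 1.
Hypothesis complete : complete_sol s.

Lemma survival_antimono rho rho' w : (forall k, 0 <= rho k) ->
  (forall k, rho k <= rho' k <= 1) -> survival rho' w <= survival rho w.
Proof.
move=> r0 rr'; rewrite /survival.
have r1 k : 0 <= 1 - rho' k <= 1 - rho k.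
  by have /andP[? ?] := rr' k; rewrite subr_ge0 lerD2l lerN2; apply/andP.
have d1 k (b : bool) : 0 <= 1 - b%:R * rho' k <= 1 - b%:R * rho k.
  by case: b; rewrite ?mul1r ?mul0r ?subr0 ?ler01 ?lexx.
apply: ler_pM; first by apply: prodr_ge0 => t _; have /andP[] := r1 (w.1 t).
- apply: prodr_ge0 => k _.
  by have /andP[] := d1 k ((k \in w.2) && (k \notin clustered s cs)).
- by apply: ler_prod => t _.
- by apply: ler_prod => k _.
Qed.

Lemma survival_eq rho rho' w : {in opened_copies w, rho =1 rho'} ->
  survival rho w = survival rho' w.
Proof.
move=> rr'; congr (_ * _); apply: eq_bigr => k _.
  by rewrite rr' // inE imset_f.
have [/andP[kw kc]|_] := boolP ((k \in w.2) && _); last by rewrite !mul0r.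
by rewrite rr' // /opened_copies inE in_setD kc kw orbT.
Qed.

(** Summation by parts turns the expression into a combination of the [G m] with the nonnegative
    increments of [c], ending with [b], as coefficients. In the induction [c n] takes the place of
    [b]. *)
Lemma abel_dominance (n : nat) (c G : nat -> R) (b : R) :
  (forall m m', (m <= m' < n)%N -> c m <= c m') -> (forall m, (m < n)%N -> c m <= b) ->
  (forall m, (m <= n)%N -> 0 <= G m) -> G 0%N = 0 ->
  0 <= \sum_(m < n) c m * (G m - G m.+1) + G n * b.
Proof.
elim: n b => [|n IHn] b cmono cb G0 G00; first by rewrite big_ord0 G00 mul0r addr0.
rewrite big_ord_recr /=.
have -> : \sum_(i < n) c i * (G i - G i.+1) + c n * (G n - G n.+1) + G n.+1 * b =
  (\sum_(i < n) c i * (G i - G i.+1) + G n * c n) + G n.+1 * (b - c n) by ring.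
apply: addr_ge0; last by rewrite mulr_ge0 ?G0 // subr_ge0 cb.
apply: IHn => [m m' /andP[mm' m'n]|m mn|m mn|//].
- by apply: cmono; rewrite mm' /= ltnW.
- by apply: cmono; rewrite (ltnW mn) leqnn.
- by apply: G0; apply: leqW.
Qed.

(* Serving [j] along [ks], a sorted list of copies thinned by [rho], costs at most
   what it would cost if a copy [k] were the first survivor with probability [l k]. *)
Lemma expectation_connection_le (X : outcome s cs -> R) (c rho l : K -> R)
    (ks : seq K) (t : 'I_(size cs)) (b : R) :
  (forall w k, k \in opened_copies w -> X w <= c k) ->
  (forall k, 0 <= rho k <= 1) -> (forall k, k \notin ks -> rho k = 0) ->
  sorted (fun k k' => c k <= c k') ks -> uniq ks -> {in ks, forall k, c k <= b} ->
  (forall m, expR (- \sum_(k <- take m ks) coin k * rho k) <=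
     1 - \sum_(k <- take m ks) l k) ->
  \sum_(k : K) xbar k (tnth (in_tuple cs) t) * (1 - rho k) * c k <=
    b * missed rho (tnth (in_tuple cs) t) ->
  expectation X <= \sum_(k <- ks) c k * l k + b * (1 - \sum_(k <- ks) l k).
Proof.
move=> Xc rho01 rho_out srt us cb expL far.
pose n := size ks.
(* [S m] is the probability that none of the first [m] copies survives the thinning, and [L m] is
   the value prescribed for it by [l]. *)
pose rhom m k := if k \in take m ks then rho k else 0.
pose S m := expectation (fun w : outcome s cs => survival (rhom m) w).
pose L m : R := 1 - \sum_(k <- take m ks) l k.
pose cm m := nth 0 (map c ks) m.
have rhom01 m k : 0 <= rhom m k <= 1.
  by rewrite /rhom; case: ifP => _ //; rewrite lexx ler01.
have rhomn : rhom n =1 rho.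
  by move=> k; rewrite /rhom take_size; case: ifPn => // /rho_out->.
have inhab m : (m < n)%N -> K by rewrite /n; case: (ks) => // k0 _ _; exact: k0.
(* The two survival values differ only if the copy at position [m] is open, and then [X w] is at
   most its cost. *)
have step w m : (m < n)%N ->
    X w * (survival (rhom m) w - survival (rhom m.+1) w) <=
    cm m * (survival (rhom m) w - survival (rhom m.+1) w).
  move=> mn; have k0 := inhab m mn; rewrite /cm (nth_map k0) //.
  have [kw|kw] := boolP (nth k0 ks m \in opened_copies w).
    apply: ler_wpM2r; last exact: Xc.
    rewrite subr_ge0; apply: survival_antimono => k.
      by have /andP[] := rhom01 m k.
    have /andP[r0 r1] := rho01 k.
    rewrite /rhom (take_nth k0 mn) mem_rcons inE.
    case: (k \in take m ks) => /=; first by rewrite orbT lexx.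
    by rewrite orbF; case: ifP => _; rewrite ?r0 ?lexx ?ler01.
  rewrite (@survival_eq (rhom m) (rhom m.+1)) ?subrr ?mulr0 // => k kw'.
  rewrite /rhom (take_nth k0 mn) mem_rcons inE.
  by case: eqP => // e; rewrite -e kw' in kw.
have surv0 w : survival (rhom 0%N) w = 1.
  by rewrite /survival !big1 ?mul1r // => k _; rewrite /rhom take0 ?mulr0 subr0.
(* The differences telescope to 1 minus the last survival; that remainder is charged to the copy
   chosen for the center [t]. *)
have pointwise w : X w <= \sum_(m < n) cm m *
    (survival (rhom m) w - survival (rhom m.+1) w) + survival rho w * c (w.1 t).
  have -> : X w = \sum_(m < n) X w * (survival (rhom m) w - survival (rhom m.+1) w)
      + survival rho w * X w.
    rewrite -mulr_sumr -(big_mkord predT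
      (fun m => survival (rhom m) w - survival (rhom m.+1) w)).
    under eq_bigr do rewrite -opprB.
    rewrite sumrN telescope_sumr // surv0.
    have -> : survival (rhom n) w = survival rho w by apply: survival_eq => k _.
    by ring.
  apply: lerD; first by apply: ler_sum => m _; exact: step.
  apply: ler_wpM2l; last by apply: Xc; rewrite inE imset_f.
  rewrite /survival mulr_ge0 //; apply: prodr_ge0 => k _; rewrite subr_ge0.
    by have /andP[] := rho01 (w.1 k).
  by have /andP[? ?] := rho01 k; case: (_ && _); rewrite ?mul1r ?mul0r.
apply: le_trans (expectation_le ybar_ge0 xbarP pointwise) _.
rewrite expectationD expectation_sum.
have Sn : expectation (survival (s := s) (cs := cs) rho) = S n.
  by apply: eq_bigr => w _; congr (_ * _); apply: survival_eq => k _.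
have S_le m : S m <= L m.
  have := expectation_survival_le cs ybar_ge0 xbarP sum_xbar complete (rhom01 m).
  move=> /le_trans; apply.
  apply: le_trans (expL m); rewrite le_eqVlt; apply/orP; left; apply/eqP.
  congr (expR (- _)).
  rewrite [RHS]big_uniq ?take_uniq //= [RHS]big_mkcond /=; apply: eq_bigr => k _.
  by rewrite /rhom; case: ifP => _; rewrite ?mulr0.
have S0 : S 0%N = 1.
  rewrite /S expectation_survival big1 => [|i _].
    by rewrite mul1r big1 // => k _; rewrite /rhom take0 !mulr0 subr0.
  rewrite -[RHS](sum_xbar (tnth (in_tuple cs) i)); apply: eq_bigr => k _.
  by rewrite /rhom take0 subr0 mulr1.
apply: (@le_trans _ _ (\sum_(m < n) cm m * (S m - S m.+1) + b * S n)).
  apply: lerD; last by rewrite -Sn; apply: expectation_survival_center.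
  by apply: ler_sum => m _; rewrite expectationZ expectationB.
(* Since [S m <= L m] with equality at 0, replacing [S] by [L] only shifts probability to more
   expensive copies or to the last resort [b]. *)
have abel := @abel_dominance n cm (fun m => L m - S m) b.
have {abel} : 0 <= \sum_(m < n) cm m * (L m - S m - (L m.+1 - S m.+1)) +
    (L n - S n) * b.
  apply: abel => [m m' /andP[mm' m'n]|m mn|m _|].
  - have k0 := inhab _ m'n; rewrite /cm !(nth_map k0) ?(leq_ltn_trans mm') //.
    have := @sorted_leq_nth _ (fun k k' : K => c k <= c k') _ _ k0 ks srt.
    apply=> //; rewrite ?inE ?(leq_ltn_trans mm') //.
    by move=> ? ? ?; exact: le_trans.
  - by have k0 := inhab _ mn; rewrite /cm (nth_map k0) // cb // mem_nth.
  - by rewrite subr_ge0.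
  - by rewrite S0 /L take0 big_nil subr0 subrr.
have -> : \sum_(k <- ks) c k * l k = \sum_(m < n) cm m * (L m - L m.+1).
  have [/eqP|n0] := posnP n.
    by rewrite /n size_eq0 => /eqP E; rewrite /n E big_nil big_ord0.
  have k0 := inhab _ n0; rewrite (big_nth k0) big_mkord; apply: eq_bigr => m _.
  rewrite /cm (nth_map k0) // /L (take_nth k0) // big_rcons /=.
  by congr (_ * _); ring.
have -> : 1 - \sum_(k <- ks) l k = L n by rewrite /L take_size.
have -> : \sum_(m < n) cm m * (L m - S m - (L m.+1 - S m.+1)) =
    \sum_(m < n) cm m * (L m - L m.+1) - \sum_(m < n) cm m * (S m - S m.+1).
  by rewrite -sumrB; apply: eq_bigr => m _; ring.
rewrite mulrBl [L n * b]mulrC [S n * b]mulrC; lra.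
Qed.

End ConnectionCost.

(** * The cost of one client *)

Section Client.
Variables (R : realType) (F C : finType) (I : ufl R F C) (gamma : R).
Variables (s : seq (copy R F C)) (x : F -> C -> R) (y : F -> R).
Let K := 'I_(size s).
Local Notation c k j := (ccost I (fac k) j).
Hypotheses (gamma_gt1 : 1 < gamma) (gamma_le2 : gamma <= 2).
Hypothesis feas : lp_feasible x y.
Hypothesis ybar_ge0 : forall k : K, 0 <= ybar k.
Hypothesis xbarP : forall (k : K) j, 0 <= xbar k j <= ybar k.
Hypothesis sum_xbar : forall j, \sum_(k < size s) xbar k j = 1.
Hypothesis sum_ybar : forall i, \sum_(k < size s | fac k == i) ybar k = gamma * y i.
Hypothesis xbar_nearest : forall (k k' : K) j,
  0 < xbar k j -> xbar k' j < ybar k' -> c k j <= c k' j.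
Hypothesis complete : complete_sol s.

Lemma far_xbar (k : K) j : k \notin close s j -> xbar k j = 0.
Proof.
rewrite inE -leNgt => xk; apply/eqP; rewrite eq_le xk.
by have /andP[] := xbarP k j.
Qed.

Lemma sum_close_xbar (f : K -> R) j :
  \sum_(k in close s j) xbar k j * f k = \sum_(k : K) xbar k j * f k.
Proof.
rewrite [RHS](bigID (mem (close s j))) /= [X in _ + X]big1 ?addr0 // => k kj.
by rewrite far_xbar ?mul0r.
Qed.

Lemma xbar_le1 (k : K) j : xbar k j <= 1.
Proof.
rewrite -(sum_xbar j) (bigD1 k) //= lerDl; apply: sumr_ge0 => k' _.
by have /andP[] := xbarP k' j.
Qed.

Lemma xbar_coin (k : K) j : 0 < xbar k j -> xbar k j = coin k.
Proof.
by move=> xk; rewrite /coin -(close_xbar xbarP complete xk) min_r // xbar_le1.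
Qed.

Lemma DavE j : Dav I gamma s j = \sum_(k : K) xbar k j * c k j.
Proof.
have g0 : gamma != 0 by rewrite gt_eqF // (lt_trans ltr01).
have ystarE k : k \in close s j -> ystar gamma k = xbar k j / gamma.
  by rewrite inE => kj; rewrite /ystar (close_xbar xbarP complete kj).
rewrite /Dav (eq_bigr _ ystarE) -mulr_suml.
have := sum_close_xbar (fun _ => 1) j.
under eq_bigr do rewrite mulr1; under [in RHS]eq_bigr do rewrite mulr1.
rewrite sum_xbar => ->; rewrite mul1r invrK -sum_close_xbar mulr_suml.
by apply: eq_bigr => k kj; rewrite ystarE //; field.
Qed.

Lemma Dmax_ge (k : K) j : 0 < xbar k j -> c k j <= Dmax I s j.
Proof.
move=> kj; rewrite /Dmax (bigmaxD1 k) ?inE //.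
by rewrite le_max lexx.
Qed.

Lemma Dmax_ge0 j : 0 <= Dmax I s j.
Proof. exact: bigmax_ge_id. Qed.

Lemma Dmax_le (k : K) j : xbar k j < ybar k -> Dmax I s j <= c k j.
Proof.
move=> kj; apply: bigmax_le => [|k']; first exact: ccost_ge0.
rewrite inE => k'j.
exact: xbar_nearest.
Qed.

Lemma close_neq0 j : close s j != set0.
Proof.
apply/eqP => E; have := sum_xbar j; rewrite big1 => [/eqP|k _].
  by rewrite eq_sym oner_eq0.
by rewrite far_xbar // E inE.
Qed.

(** The LP connection scaled by [gamma], spread over the copies of a facility in proportion to their
    openings. If [y] vanishes there, so does [x], and the value 0 of the quotient is correct. *)
Let frac (k : K) j := x (fac k) j / y (fac k) * ybar k.

Let sum_frac (h : F -> R) j :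
  \sum_(k : K) h (fac k) * frac k j = gamma * \sum_i h i * x i j.
Proof.
rewrite (partition_big (@fac _ _ _ s) predT) //= mulr_sumr; apply: eq_bigr => i _.
transitivity (h i * (x i j / y i) * \sum_(k < size s | fac k == i) ybar k).
  by rewrite mulr_sumr; apply: eq_bigr => k /eqP ki; rewrite /frac ki mulrA.
rewrite sum_ybar; have [_ xy x0 _] := feas.
have [y0|yn0] := eqVneq (y i) 0; last by field.
have -> : x i j = 0 by apply/eqP; rewrite eq_le x0 -y0 xy.
by rewrite !(mul0r, mulr0).
Qed.

Let frac_bounds (k : K) j : 0 <= frac k j <= ybar k.
Proof.
have [_ xy x0 y0] := feas; rewrite /frac; apply/andP; split.
  by rewrite mulr_ge0 // divr_ge0.
rewrite ler_piMl //; have [->|yn0] := eqVneq (y (fac k)) 0.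
  by rewrite invr0 mulr0 ler01.
by rewrite ler_pdivrMr ?mul1r // lt_neqAle eq_sym yn0 y0.
Qed.

(* Outside its close copies, [j] keeps a share of its scaled LP solution. *)
Lemma distant_weights j : exists b : K -> R,
  [/\ forall k, k \in close s j -> b k = xbar k j,
      forall k, 0 <= b k <= coin k,
      \sum_(k | k \notin close s j) b k = gamma - 1,
      \sum_(k : K) b k * c k j <= gamma * \sum_i ccost I i j * x i j
    & forall k, k \notin close s j -> 0 < b k -> Dmax I s j <= c k j].
Proof.
have closeE : \sum_(k in close s j) xbar k j = 1.
  have := sum_close_xbar (fun _ => 1) j.
  under eq_bigr do rewrite mulr1; under [in RHS]eq_bigr do rewrite mulr1.
  by rewrite sum_xbar.
pose G := \sum_(k in close s j) frac k j.
pose H := \sum_(k | k \notin close s j) frac k j.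
have GH : G + H = gamma.
  have := sum_frac (fun _ => 1) j; under eq_bigr do rewrite mul1r.
  under [in RHS]eq_bigr do rewrite mul1r.
  have [-> _ _ _] := feas; rewrite mulr1 => <-.
  by rewrite [RHS](bigID (mem (close s j))).
have G1 : G <= 1.
  rewrite -closeE; apply: ler_sum => k; rewrite inE => kj.
  by rewrite (close_xbar xbarP complete kj); have /andP[] := frac_bounds k j.
have H0 : 0 < H by rewrite -(ltrD2l G) addr0 GH (le_lt_trans G1).
(* Close copies carry [G <= 1] of the scaled solution, so the distant mass [H] is at least
   [gamma - 1] and is shrunk to exactly that amount. *)
pose lam := (gamma - 1) / H.
have lam0 : 0 <= lam by rewrite divr_ge0 // ?subr_ge0 ltW.
have lam1 : lam <= 1 by rewrite ler_pdivrMr // mul1r lerBlDr -GH addrC lerD2l.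
have lamH : lam * H = gamma - 1 by rewrite divfK // gt_eqF.
pose b k := if k \in close s j then xbar k j else lam * frac k j.
have far k : k \notin close s j -> 0 < frac k j -> Dmax I s j <= c k j.
  move=> kj fk; apply: Dmax_le; rewrite far_xbar //.
  by apply: lt_le_trans fk _; have /andP[] := frac_bounds k j.
have sumb : \sum_(k | k \notin close s j) b k = gamma - 1.
  rewrite -lamH mulr_sumr; apply: eq_bigr => k /negPf kj.
  by rewrite /b kj.
exists b; split => // [k kj|k||k kj].
- by rewrite /b kj.
- rewrite /b; case: ifPn => kj.
    have kj' : 0 < xbar k j by move: kj; rewrite inE.
    by rewrite -(xbar_coin kj') (ltW kj') lexx.
  have /andP[f0 fy] := frac_bounds k j.
  rewrite mulr_ge0 //= /coin le_min; apply/andP; split.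
    (* The cap 1 in [coin] is respected because even the total distant mass is [gamma - 1 <= 1]. *)
    apply: (@le_trans _ _ (lam * H)); last by rewrite lamH lerBlDr.
    rewrite ler_wpM2l // /H (bigD1 k) //= lerDl; apply: sumr_ge0 => k' _.
    by have /andP[] := frac_bounds k' j.
  by apply: le_trans fy; rewrite ler_piMl.
- rewrite -(sum_frac (fun i => ccost I i j)) -subr_ge0 -sumrB.
  (* Passing from [frac] to [b] adds mass at cost at most [Dmax] and removes as much at cost at
     least [Dmax]. The balance of mass is zero, so each change of cost is compared with [Dmax] times
     the change of mass. *)
  apply: (@le_trans _ _ (Dmax I s j * ((G - 1) + (H - (gamma - 1))))).
    by rewrite (_ : G - 1 + _ = 0) ?mulr0 //; lra.
  have -> : Dmax I s j * ((G - 1) + (H - (gamma - 1))) =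
      \sum_(k in close s j) Dmax I s j * (frac k j - xbar k j) +
      \sum_(k | k \notin close s j) Dmax I s j * (frac k j - b k).
    by rewrite -!mulr_sumr !sumrB closeE sumb mulrDr.
  rewrite [leRHS](bigID (mem (close s j))) /=; apply: lerD; apply: ler_sum => k kj.
    have Dk : c k j <= Dmax I s j by apply: Dmax_ge; move: kj; rewrite inE.
    have fk : frac k j <= xbar k j.
      have -> : xbar k j = ybar k.
        by apply: (close_xbar xbarP complete); move: kj; rewrite inE.
      by have /andP[] := frac_bounds k j.
    have : 0 <= (Dmax I s j - c k j) * (xbar k j - frac k j).
      by rewrite mulr_ge0 ?subr_ge0.
    rewrite /b kj; lra.
  rewrite /b (negPf kj).
  have /andP[] := frac_bounds k j; rewrite le_eqVlt => /predU1P[<- _|fk _].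
    by rewrite !(mulr0, mul0r, subr0).
  have := far k kj fk => Dk.
  have : 0 <= (1 - lam) * frac k j * (c k j - Dmax I s j).
    by apply: mulr_ge0; [apply: mulr_ge0; [rewrite subr_ge0|exact: ltW]|rewrite subr_ge0].
  by lra.
- rewrite /b (negPf kj) => bk; apply: far => //.
  rewrite lt_neqAle; have /andP[-> _] := frac_bounds k j; rewrite andbT.
  by apply: contraTneq bk => <-; rewrite mulr0 ltxx.
Qed.

(* Averaging the detour from [j] through a copy [i] to the center [j'] and on to a
   missed copy, over all the copies [i] serving [j']. *)
Lemma missed_cost_le (j j' : C) (b rho : K -> R) : neighbors s j' j ->
  (forall k, 0 <= rho k <= 1) -> (forall k, k \in close s j -> rho k = 1) ->
  (forall k, k \notin close s j -> coin k * rho k <= b k) ->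
  (forall k, 0 <= b k) ->
  (forall k, k \notin close s j -> 0 < b k -> Dmax I s j <= c k j) ->
  \sum_(k : K) xbar k j' * (1 - rho k) * c k j <=
  (Dmax I s j + (Dav I gamma s j' + Dmax I s j')
    + \sum_(k | k \notin close s j) b k * (c k j - Dmax I s j)) * missed rho j'.
Proof.
move=> /existsP[i0]; rewrite inE => /andP[]; rewrite !inE => i0j' i0j.
move=> rho01 rho_close rho_far b0 bD.
set M := Dmax I s j'; set D := Dmax I s j; set V := \sum_(k : K) _.
pose v k := xbar k j' * (1 - rho k).
pose W := missed rho j'.
have a0 (k : K) : 0 <= xbar k j' by have /andP[] := xbarP k j'.
have v0 k : 0 <= v k by rewrite mulr_ge0 // subr_ge0; have /andP[] := rho01 k.
have W0 : 0 <= W by apply: sumr_ge0 => k _; exact: v0.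
have detour (i : K) : V <= W * (c i j + c i j') + \sum_(k : K) v k * c k j'.
  rewrite /V /W mulr_suml -big_split; apply: ler_sum => k _ /=.
  rewrite -/(v k) -mulrDr ler_wpM2l //.
  by have := ccost_metric I (fac k) (fac i) j j'; lra.
have vM : \sum_(k : K) v k * c k j' <= W * M.
  rewrite mulr_suml; apply: ler_sum => k _.
  have := a0 k; rewrite le_eqVlt => /predU1P[e|ak]; first by rewrite /v -e !mul0r.
  by apply: ler_wpM2l; [exact: v0|exact: Dmax_ge].
have V_through (i : K) : V <= W * (c i j + c i j' + M).
  by apply: le_trans (detour i) _; rewrite [leRHS]mulrDr lerD2l.
(* The missed share of the average goes through the common copy [i0], at distance at most [D] from
   [j] and at most [M] from [j']. *)
have part1 : W * V <= W * \sum_(k : K) v k * (D + M + c k j').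
  apply: ler_wpM2l => //; apply: le_trans (detour i0) _.
  have -> : \sum_(k : K) v k * (D + M + c k j') =
      W * (D + M) + \sum_(k : K) v k * c k j'.
    by rewrite mulr_suml -big_split; apply: eq_bigr => k _ /=; rewrite mulrDr.
  by rewrite lerD2r ler_wpM2l // lerD //; apply: Dmax_ge.
(* The remaining share goes through the copy [k] itself: a close one costs at most [D], and the
   excess of a distant one over [D] is paid by [b]. *)
have part2 : \sum_(k : K) xbar k j' * rho k * V <=
    W * (\sum_(k : K) xbar k j' * rho k * (D + M + c k j')
      + \sum_(k | k \notin close s j) b k * (c k j - D)).
  rewrite [X in _ + X]big_mkcond -big_split mulr_sumr; apply: ler_sum => k _ /=.
  have /andP[r0 r1] := rho01 k.
  have ar0 : 0 <= xbar k j' * rho k by rewrite mulr_ge0.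
  case: ifPn => [kj|]; last first.
    rewrite negbK addr0 mulrCA => kj; apply: ler_wpM2l => //.
    apply: le_trans (V_through k) _; rewrite ler_wpM2l //.
    suff : c k j <= D by lra.
    by apply: Dmax_ge; move: kj; rewrite inE.
  apply: (@le_trans _ _ (xbar k j' * rho k * (W * (c k j + c k j' + M)))).
    by rewrite ler_wpM2l.
  rewrite mulrCA ler_wpM2l //.
  have -> : xbar k j' * rho k * (c k j + c k j' + M) =
    xbar k j' * rho k * (D + M + c k j') + xbar k j' * rho k * (c k j - D) by ring.
  rewrite lerD2l.
  have arb : xbar k j' * rho k <= b k.
    have := a0 k; rewrite le_eqVlt => /predU1P[<-|ak]; first by rewrite mul0r b0.
    by rewrite (xbar_coin ak) rho_far.
  have := b0 k; rewrite le_eqVlt => /predU1P[e|bk].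
    suff -> : xbar k j' * rho k = 0 by rewrite -e !mul0r.
    by apply/eqP; rewrite eq_le ar0 e arb.
  by rewrite ler_wpM2r // subr_ge0 bD.
(* The weights of the two parts add up to the unit mass serving [j']. *)
have VE : V = W * V + \sum_(k : K) xbar k j' * rho k * V.
  rewrite -mulr_suml -mulrDl /W /missed -big_split /=.
  under eq_bigr do rewrite -mulrDr subrK mulr1.
  by rewrite sum_xbar mul1r.
rewrite -/W mulrC VE; apply: le_trans (lerD part1 part2) _.
rewrite -mulrDr ler_wpM2l // addrA lerD2r -big_split /=.
rewrite le_eqVlt; apply/orP; left; apply/eqP.
transitivity (\sum_(k : K) (xbar k j' * (D + M) + xbar k j' * c k j')).
  by apply: eq_bigr => k _; rewrite /v; ring.
by rewrite big_split /= -mulr_suml sum_xbar -DavE; ring.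
Qed.

End Client.

(** * The connection bound for a single client *)

Section ClientBound.
Variables (R : realType) (F C : finType) (I : ufl R F C) (gamma : R).
Variables (s : seq (copy R F C)) (x : F -> C -> R) (y : F -> R) (cs : seq C).
Let K := 'I_(size s).
Hypotheses (gamma_gt1 : 1 < gamma) (gamma_le2 : gamma <= 2).
Hypothesis gammaP : gamma_eq gamma.
Hypothesis feas : lp_feasible x y.
Hypothesis ybar_ge0 : forall k : K, 0 <= ybar k.
Hypothesis xbarP : forall (k : K) j, 0 <= xbar k j <= ybar k.
Hypothesis sum_xbar : forall j, \sum_(k < size s) xbar k j = 1.
Hypothesis sum_ybar : forall i, \sum_(k < size s | fac k == i) ybar k = gamma * y i.
Hypothesis xbar_nearest : forall (k k' : K) j,
  0 < xbar k j -> xbar k' j < ybar k' -> ccost I (fac k) j <= ccost I (fac k') j.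
Hypothesis complete : complete_sol s.
Hypothesis clusters : clustering I gamma s [set: C] cs.

Let sum_seq_le (f : K -> R) (P : {pred K}) (r : seq K) : uniq r -> {subset r <= P} ->
  (forall k, 0 <= f k) -> \sum_(k <- r) f k <= \sum_(k in P) f k.
Proof.
move=> ur rP f0; rewrite big_uniq //= big_mkcond [leRHS]big_mkcond.
by apply: ler_sum => k _; case: ifP => [/rP->//|_]; case: ifP.
Qed.

Let a : R := (expR 1)^-1.
Let e : R := (expR gamma)^-1.

Lemma expR_chord01 (u : R) : 0 <= u <= 1 -> expR (- u) <= 1 - (1 - a) * u.
Proof.
move=> u01; have := expR_chord 0 (-1) u01.
rewrite expR0 (expRN 1) -/a mulr0 add0r mulrN1 => /le_trans; apply.
by rewrite le_eqVlt; apply/orP; left; apply/eqP; ring.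
Qed.

Lemma expR_chord1gamma (u : R) : 0 <= u <= gamma - 1 ->
  expR (- (1 + u)) <= a - (a - e) / (gamma - 1) * u.
Proof.
move=> /andP[u0 ug]; have g0 : 0 < gamma - 1 by rewrite subr_gt0.
have t01 : 0 <= u / (gamma - 1) <= 1.
  by rewrite divr_ge0 ?(ltW g0) //= ler_pdivrMr // mul1r.
have := expR_chord (-1) (- gamma) t01; rewrite (expRN 1) (expRN gamma) -/a -/e.
have g0' : gamma - 1 != 0 by rewrite gt_eqF.
have -> : (1 - u / (gamma - 1)) * -1 + u / (gamma - 1) * - gamma = - (1 + u) by field.
move=> /le_trans; apply.
by rewrite le_eqVlt; apply/orP; left; apply/eqP; field.
Qed.

Lemma expectation_client_le (X : outcome s cs -> R) j :
  (forall w k, k \in opened_copies w -> X w <= ccost I (fac k) j) ->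
  expectation X <= (1 + 2 / expR gamma) * \sum_i ccost I i j * x i j.
Proof.
pose c (k : K) := ccost I (fac k) j => Xc.
have g1 : 0 < gamma - 1 by rewrite subr_gt0.
have [b [b_close b_coin sum_b cost_b b_far]] := distant_weights gamma_gt1 gamma_le2
  feas ybar_ge0 xbarP sum_xbar sum_ybar xbar_nearest complete j.
have b0 k : 0 <= b k by have /andP[] := b_coin k.
have [t [nt Dt]] :=
  clustering_center clusters (in_setT j) (close_neq0 xbarP sum_xbar j).
set j' := tnth _ t in nt Dt.
pose D := Dmax I s j; pose Y := \sum_(k | k \notin close s j) b k * c k.
have far_ge0 k : k \notin close s j -> 0 <= b k * (c k - D).
  move=> kj; have := b0 k; rewrite le_eqVlt => /predU1P[<-|bk]; first by rewrite mul0r.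
  by rewrite mulr_ge0 // subr_ge0 b_far.
have FE : \sum_(k | k \notin close s j) b k * (c k - D) = Y - (gamma - 1) * D.
  rewrite -sum_b mulr_suml -sumrB; apply: eq_bigr => k _; ring.
have DY : (gamma - 1) * D <= Y by rewrite -subr_ge0 -FE; exact: sumr_ge0.
have D0 : 0 <= D := Dmax_ge0 I s j.
have DavE' := DavE I gamma_gt1 xbarP sum_xbar complete j.
have Dav0 : 0 <= Dav I gamma s j.
  rewrite DavE'; apply: sumr_ge0 => k _.
  by rewrite mulr_ge0 ?ccost_ge0 //; have /andP[] := xbarP k j.
pose B := 2 * D + Dav I gamma s j + (Y - (gamma - 1) * D).
have DB : D <= B by rewrite /B; lra.
(* A far copy more expensive than [B], the bound for reaching [j] through its
   center, is better left unused. *)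
pose sel (k : K) := (k \notin close s j) && (0 < b k) && (c k <= B).
(* Thinning makes the effective opening [coin k * rho k] equal to [b k] on every copy that is
   used. *)
pose rho (k : K) := if k \in close s j then 1 else if sel k then b k / coin k else 0.
have coin_rho k : coin k * rho k = if (k \in close s j) || sel k then b k else 0.
  rewrite /rho; case: ifPn => kj /=.
    have kj' : 0 < xbar k j by move: kj; rewrite inE.
    by rewrite mulr1 b_close // (xbar_coin xbarP sum_xbar complete kj').
  case: ifP => [/andP[/andP[_ bk] _]|]; last by rewrite mulr0.
  rewrite mulrC divfK // gt_eqF // (lt_le_trans bk) //.
  by have /andP[] := b_coin k.
have rho01 k : 0 <= rho k <= 1.
  rewrite /rho; case: ifP => _; first by rewrite ler01 lexx.
  case: ifP => [/andP[/andP[_ bk] _]|]; last by rewrite lexx ler01.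
  have /andP[_ bc] := b_coin k; have ck := lt_le_trans bk bc.
  by rewrite divr_ge0 ?(ltW ck) //= ler_pdivrMr // mul1r.
pose le (k k' : K) := c k <= c k'.
pose s1 := sort le (enum (close s j)); pose s2 := sort le (enum sel).
have us1 : uniq s1 by rewrite sort_uniq enum_uniq.
have us2 : uniq s2 by rewrite sort_uniq enum_uniq.
have ms1 k : (k \in s1) = (k \in close s j) by rewrite mem_sort mem_enum.
have ms2 k : (k \in s2) = sel k by rewrite mem_sort mem_enum.
(* Minus the slopes of the chords of exp(-u) over [0, 1] and [1, gamma]. *)
pose l1 := 1 - a; pose l2 := (a - e) / (gamma - 1).
pose l (k : K) := if k \in close s j then l1 * xbar k j else l2 * b k.
have e_gt0 : 0 < e by rewrite invr_gt0 expR_gt0.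
have ea : e < a by exact: inv_expR_lt.
have a1 : a < 1 by have := inv_expR1_bounds R; rewrite -/a; lra.
have l2g : l2 * (gamma - 1) = a - e by rewrite divfK // gt_eqF.
have l20 : 0 <= l2 by rewrite divr_ge0 ?(ltW g1) // subr_ge0 ltW.
have sum_close : \sum_(k in close s j) xbar k j = 1.
  rewrite -(sum_xbar j) [RHS](bigID (mem (close s j))) /= [X in _ + X]big1 ?addr0 //.
  by move=> k kj; rewrite (far_xbar xbarP kj).
have x0 (k : K) : 0 <= xbar k j by have /andP[] := xbarP k j.
have sum_s1 (f : K -> R) : \sum_(k <- s1) f k = \sum_(k in close s j) f k.
  by rewrite (perm_big _ (permEl (perm_sort _ _))) big_enum.
have sum_s2 (f : K -> R) : \sum_(k <- s2) f k = \sum_(k | sel k) f k.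
  by rewrite (perm_big _ (permEl (perm_sort _ _))) big_enum.
have sel_far k : sel k -> k \notin close s j by case/andP => /andP[].
have sum_l_close : \sum_(k in close s j) l k = l1.
  by rewrite -[RHS]mulr1 -sum_close mulr_sumr; apply: eq_bigr => k kj; rewrite /l kj.
have bound := @expectation_connection_le R F C s cs ybar_ge0 xbarP sum_xbar complete
  X c rho l (s1 ++ s2) t B Xc rho01.
have {bound} bound : expectation X <=
    \sum_(k <- s1 ++ s2) c k * l k + B * (1 - \sum_(k <- s1 ++ s2) l k).
  apply: bound.
  - move=> k; rewrite mem_cat ms1 ms2 negb_or /rho => /andP[/negPf-> /negPf->] //.
  - have le_tr : transitive le by move=> ? ? ?; exact: le_trans.
    have tot : total le by move=> ? ?; exact: le_total.
    rewrite (sorted_pairwise le_tr) pairwise_cat -!(sorted_pairwise le_tr).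
    rewrite !(sort_sorted tot) !andbT; apply/allrelP => k k'.
    rewrite ms1 ms2 => kj /andP[/andP[k'j bk'] _].
    apply: le_trans (b_far _ k'j bk'); apply: Dmax_ge.
    by move: kj; rewrite inE.
  - rewrite cat_uniq us1 us2 andbT /=; apply/hasPn => k; rewrite ms2 => /sel_far.
    by rewrite /= ms1.
  - move=> k; rewrite mem_cat ms1 ms2 => /orP[kj|/andP[]//].
    by apply: le_trans DB; apply: Dmax_ge; move: kj; rewrite inE.
  - move=> m; rewrite take_cat; case: ifP => _.
      have sub k : k \in take m s1 -> k \in close s j by move=> /mem_take; rewrite ms1.
      rewrite (eq_big_seq (fun k => xbar k j)) => [|k /sub kj]; last first.
        by rewrite coin_rho kj b_close.
      rewrite [in leRHS](eq_big_seq (fun k => l1 * xbar k j)) => [|k /sub kj];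
        last first.
        by rewrite /l kj.
      rewrite -mulr_sumr; apply: expR_chord01; apply/andP; split.
        by apply: sumr_ge0 => k _.
      rewrite -sum_close; apply: sum_seq_le => //; first exact: take_uniq.
    set r := take _ s2.
    have sub k : k \in r -> sel k by move=> /mem_take; rewrite ms2.
    rewrite !big_cat /= !sum_s1.
    have -> : \sum_(k in close s j) coin k * rho k = 1.
      by rewrite -sum_close; apply: eq_bigr => k kj; rewrite coin_rho kj b_close.
    have -> : \sum_(k <- r) coin k * rho k = \sum_(k <- r) b k.
      by apply: eq_big_seq => k /sub selk; rewrite coin_rho selk orbT.
    have -> : \sum_(k <- r) l k = l2 * \sum_(k <- r) b k.
      rewrite mulr_sumr; apply: eq_big_seq => k /sub/sel_far/negPf kj.
      by rewrite /l kj.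
    rewrite sum_l_close.
    have -> z : 1 - (l1 + l2 * z) = a - l2 * z by rewrite /l1; ring.
    apply: expR_chord1gamma; apply/andP; split; first by apply: sumr_ge0 => k _.
    rewrite -sum_b; apply: (@sum_seq_le b [pred k | k \notin close s j]) => //.
      exact: take_uniq.
    by move=> k /sub/sel_far.
  - apply: le_trans (missed_cost_le gamma_gt1 xbarP sum_xbar complete nt rho01
      _ _ b0 b_far) _.
    + by move=> k kj; rewrite /rho kj.
    + by move=> k kj; rewrite coin_rho; case: ifP.
    + apply: ler_wpM2r; last first.
        (* The choice of centers replaces the sum of [Dav] and [Dmax] at [j'] by that at [j], which
           gives [B]. *)
        by rewrite FE /B; move: Dt; rewrite -/D; lra.
      apply: sumr_ge0 => k _; have /andP[? _] := xbarP k j'; have /andP[_ ?] := rho01 k.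
      by rewrite mulr_ge0 // subr_ge0.
apply: le_trans bound _.
rewrite !big_cat /= !sum_s1 !sum_s2 sum_l_close.
have -> : \sum_(k in close s j) c k * l k = l1 * Dav I gamma s j.
  rewrite DavE' -(sum_close_xbar xbarP) mulr_sumr; apply: eq_bigr => k kj.
  by rewrite /l kj -/(c k); ring.
have lsel k : sel k -> l k = l2 * b k by move=> /sel_far/negPf kj; rewrite /l kj.
have -> : \sum_(k | sel k) l k = l2 * \sum_(k | sel k) b k.
  by rewrite mulr_sumr; exact: eq_bigr.
have -> : \sum_(k | sel k) c k * l k = l2 * \sum_(k | sel k) b k * c k.
  by rewrite mulr_sumr; apply: eq_bigr => k selk; rewrite lsel //; ring.
have split_far (f : K -> R) : \sum_(k | k \notin close s j) f k =
    \sum_(k | sel k) f k + \sum_(k | (k \notin close s j) && ~~ sel k) f k.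
  rewrite (bigID sel) /=; congr (_ + _); apply: eq_bigl => k.
  by apply: andb_idl; exact: sel_far.
(* The mass of the unselected copies falls to the last resort, where it costs [B] per unit, no more
   than serving it by these copies would. *)
have unsel : B * \sum_(k | (k \notin close s j) && ~~ sel k) b k <=
    \sum_(k | (k \notin close s j) && ~~ sel k) b k * c k.
  rewrite mulr_sumr; apply: ler_sum => k /andP[kj]; rewrite /sel kj /=.
  have := b0 k; rewrite le_eqVlt => /predU1P[<- _|bk]; first by rewrite mulr0 mul0r.
  by rewrite bk /= -ltNge => Bc; rewrite mulrC ler_wpM2l // ltW.
have YE := split_far (fun k => b k * c k); rewrite -/Y in YE.
have bE := split_far b; rewrite sum_b in bE.
have DavY : Dav I gamma s j + Y <= gamma * \sum_i ccost I i j * x i j.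
  apply: le_trans cost_b; rewrite [leRHS](bigID (mem (close s j))) /= -/Y lerD2r.
  rewrite DavE' -(sum_close_xbar xbarP) le_eqVlt; apply/orP; left; apply/eqP.
  by apply: eq_bigr => k kj; rewrite b_close.
move: unsel YE bE; set bs := \sum_(k | sel k) b k; set Ys := \sum_(k | sel k) _.
set bu := \sum_(k | _ && _) b k; set Yu := \sum_(k | _ && _) _ => unsel YE bE.
have gP := gamma_eq_factor gammaP; rewrite -/a -/e in gP.
have step1 : l1 * Dav I gamma s j + l2 * Ys + B * (1 - (l1 + l2 * bs)) <=
    l1 * Dav I gamma s j + l2 * Y + B * e.
  have -> : 1 - (l1 + l2 * bs) = e + l2 * bu.
    have -> : bs = gamma - 1 - bu by rewrite bE; ring.
    by rewrite mulrBr l2g /l1; ring.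
  have : l2 * (B * bu) <= l2 * Yu by exact: ler_wpM2l.
  by rewrite YE; lra.
apply: le_trans step1 _.
(* [D <= Y / (gamma - 1)], the average cost of the distant copies. *)
have BY : B <= Dav I gamma s j + 2 / (gamma - 1) * Y.
  have : 0 <= (3 - gamma) / (gamma - 1) * (Y - (gamma - 1) * D).
    apply: mulr_ge0; last by rewrite subr_ge0.
    apply: divr_ge0; last exact: ltW.
    by rewrite subr_ge0 (le_trans gamma_le2) // ler_nat.
  have g0' : gamma - 1 != 0 by rewrite gt_eqF.
  have -> : (3 - gamma) / (gamma - 1) * (Y - (gamma - 1) * D) =
    2 / (gamma - 1) * Y - Y - (3 - gamma) * D by field.
  by rewrite /B; lra.
have eB : B * e <= (Dav I gamma s j + 2 / (gamma - 1) * Y) * e.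
  by rewrite ler_wpM2r // ltW.
(* The equation for [gamma] reads (gamma - 1)(1 - a + e) = a + e; adding 1 - a + e gives 1 + 2e. *)
have -> : 1 + 2 / expR gamma = gamma * (1 - a + e).
  have -> : gamma * (1 - a + e) = (1 - a + e) + (gamma - 1) * (1 - a + e) by ring.
  by rewrite -gP; rewrite -/e; ring.
apply: (@le_trans _ _ ((1 - a + e) * (Dav I gamma s j + Y))); last first.
  by rewrite [gamma * _]mulrC -mulrA ler_wpM2l //; lra.
(* The coefficient of [Y] is (a + e) / (gamma - 1), which the same equation makes equal to [l1 + e],
   the coefficient of [Dav]. *)
have l2e : l2 + 2 / (gamma - 1) * e = 1 - a + e.
  have g0' : gamma - 1 != 0 by rewrite gt_eqF.
  have -> : 1 - a + e = (a + e) / (gamma - 1) by rewrite gP; field.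
  by rewrite /l2; field.
have -> : (1 - a + e) * (Dav I gamma s j + Y) =
  l1 * Dav I gamma s j + l2 * Y + (Dav I gamma s j + 2 / (gamma - 1) * Y) * e.
  by rewrite mulrDr -{2}l2e /l1; ring.
by rewrite lerD2l.
Qed.

End ClientBound.

(** * The theorem *)

Section Run.
Variables (R : realType) (F C : finType) (I : ufl R F C) (gamma : R).
Variable r : run R F C.
Hypothesis gamma_ge1 : 1 <= gamma.
Hypothesis runP : A1_run I gamma r.

(** The existence of a client forces a center, and every outcome opens the copy chosen for it. *)
Lemma opened_neq0 (w : outcome (run_copies r) (run_centers r)) (j : C) :
  opened w != set0.
Proof.
have [feas _] := A1_lp runP.
have cj : close (run_copies r) j != set0.
  apply: close_neq0.
    exact: xbar_bounds gamma_ge1 feas (A1_split runP).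
  exact: sum_xbar gamma_ge1 feas (A1_ord runP) (A1_split runP).
have [t _] := clustering_center (A1_cluster runP) (in_setT j) cj.
by apply/set0Pn; exists (fac (w.1 t)); apply: imset_f; rewrite inE imset_f.
Qed.

Lemma A1_feasible (w : outcome (run_copies r) (run_centers r)) :
  sol_feasible (A1_solution r w).
Proof. by move=> j; have [] := A1_connect runP j (opened_neq0 w j). Qed.

Lemma A1_cost : 1 < gamma -> gamma <= 2 -> gamma_eq gamma ->
  expectation (fun w => sol_cost I (A1_solution r w)) <=
  gamma * lp_fcost I (run_y r) + (1 + 2 / expR gamma) * lp_ccost I (run_x r).
Proof.
move=> g1 g2 gP; have [feas _] := A1_lp runP.
have ord := A1_ord runP; have splitP := A1_split runP.
have y0 := ybar_ge0 gamma_ge1 feas splitP.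
have xP := xbar_bounds gamma_ge1 feas splitP.
have sx := sum_xbar gamma_ge1 feas ord splitP.
have sy := sum_ybar splitP.
have near := xbar_nearest gamma_ge1 feas ord splitP.
rewrite expectationD; apply: lerD.
  apply: le_trans (expectation_facility_le y0 xP sx (fcost_ge0 I) _) _.
    by move=> k; exact: (clustering_sum_xbar xP (y0 k) (A1_cluster runP)).
  rewrite (partition_big (@fac _ _ _ (run_copies r)) predT) //= /lp_fcost mulr_sumr.
  apply: ler_sum => i _.
  rewrite (eq_bigr (fun k => fcost I i * ybar k)) => [|k /eqP -> //].
  by rewrite -mulr_sumr sy mulrCA.
rewrite expectation_sum /lp_ccost [in leRHS]exchange_big /= [in leRHS]mulr_sumr.
apply: ler_sum => j _.
apply: (expectation_client_le g1 g2 gP feas y0 xP sx sy near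
  (A1_complete runP) (A1_cluster runP)) => w k kw.
have [_] := A1_connect runP j (opened_neq0 w j); apply.
exact: imset_f.
Qed.

End Run.

Theorem theorem1 (R : realType) :
  exists gamma0 : R,
    unique (fun g : R => 0 < g /\ gamma_eq g) gamma0 /\
    forall (F C : finType) (I : ufl R F C),
      ((exists s : solution F C, sol_feasible s) ->
         exists r : run R F C, A1_run I gamma0 r) /\
      forall r : run R F C, A1_run I gamma0 r ->
        (forall w, 0 < prob w -> sol_feasible (A1_solution r w)) /\
        expectation (fun w => sol_cost I (A1_solution r w))
          <= gamma0 * lp_fcost I (run_y r)
             + (1 + 2 / expR gamma0) * lp_ccost I (run_x r).
Proof.
have [g g12 gP] := gamma_eq_exists R; have /andP[g1 g2] := g12.
have g0 : 0 < g := lt_trans ltr01 g1.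
exists g; split; first by split=> // h [_]; exact: gamma_eq_unique.
move=> F C I; split; first exact: A1_run_exists.
move=> r runP; split=> [w _|]; first exact: A1_feasible (ltW g1) runP w.
exact: A1_cost (ltW g1) runP g1 (ltW g2) gP.
Qed.
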